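(* Let $T^2$ be a torus (compact Riemann surface of genus one) and let $\varphi:T^2\to G_k(\mathbb{C}^n)$ be a harmonic map which is simultaneously of finite uniton number and of finite type. Then $\varphi$ is constant.
   Context: A smooth map $\varphi:M\to G_k(\mathbb{C}^n)$ from a Riemann surface is identified with the corresponding rank-$k$ subbundle of $M\times\mathbb{C}^n$, and is regarded as a map into $U(n)$ via the (totally geodesic) Cartan embedding $\varphi\mapsto\pi_\varphi-\pi_\varphi^\perp$, where $\pi_\varphi,\pi_\varphi^\perp$ are orthogonal projections onto $\varphi$ and $\varphi^\perp$. $z$ denotes a local complex coordinate and $\Gamma(\cdot)$ smooth sections. Finite uniton number: for smooth $\varphi:M\to U(n)$ put $A^\varphi_z=\frac12\varphi^{-1}\partial_z\varphi$, $A^\varphi_{\bar z}=\frac12\varphi^{-1}\partial_{\bar z}\varphi$. A uniton for a harmonic $\varphi:M\to U(n)$ is a subbundle $\alpha$ of $M\times\mathbb{C}^n$ with $\Gamma(\alpha)$ closed under $\partial_{\bar z}+A^\varphi_{\bar z}$ and under $A^\varphi_z$. $\varphi$ is of finite uniton number if $\varphi=\varphi_0(\pi_{\alpha_1}-\pi_{\alpha_1}^\perp)\cdots(\pi_{\alpha_s}-\pi_{\alpha_s}^\perp)$ for some $s\ge0$, with $\varphi_0\in U(n)$ constant and each $\alpha_i$ a uniton for the partial product of the first $i-1$ factors (times $\varphi_0$). Finite type: an extended solution is a smooth map $\Phi:S^1\times M\to U(n)$ with $\Phi(1,\cdot)=I$ such that, locally, $\Phi(\lambda,\cdot)^{-1}d\Phi(\lambda,\cdot)=(1-\lambda^{-1})A_zdz+(1-\lambda)A_{\bar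 z}d\bar z$ for some $\mathfrak{gl}(n,\mathbb{C})$-valued maps $A_z,A_{\bar z}$; it is associated to $\varphi$ if $\Phi(-1,\cdot)=u\varphi$ for some constant $u\in U(n)$. Let $\mathcal{H}_+\subset L^2(S^1,\mathbb{C}^n)$ be the closed subspace of Fourier series whose negative coefficients vanish; $\Phi$ corresponds to the family of closed subspaces $W(z)=\Phi(\cdot,z)\mathcal{H}_+$, which determines $\Phi$ and is also called an extended solution. A harmonic map is of finite type if it admits an associated extended solution of the form $W(z)=\exp(\xi z)\mathcal{H}_+$ with $\xi=\sum_{k=-1}^d\xi_k\lambda^k$, $\xi_k\in\mathfrak{gl}(n,\mathbb{C})$, constant with respect to $z$. For a harmonic map from $T^2$ this is understood for its lift to the universal cover $\mathbb{C}$, with $z$ the standard coordinate. *)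

(* Defs.v *)
From mathcomp Require Import all_boot all_order all_algebra.
From mathcomp Require Import complex spectral sesquilinear.
From mathcomp Require Import all_classical all_reals all_analysis.

Set Implicit Arguments.
Unset Strict Implicit.
Unset Printing Implicit Defensive.

Import Order.TTheory GRing.Theory Num.Theory.
Import numFieldNormedType.Exports.

Local Open Scope classical_set_scope.
Local Open Scope complex_scope.
Local Open Scope sesquilinear_scope.
Local Open Scope ring_scope.

(* All iterated directional derivatives of order at most [k] exist everywhere and
   are continuous; [V] is only used with V = R^2 and V = R^3, where this is the
   usual class C^k. *)
Fixpoint Ck (R : realType) (V : normedModType R) (k : nat) (f : V -> R) : Prop :=
  continuous f /\
  (if k is k'.+1 then
     forall v : V, (forall x, derivable f x v) /\ Ck k' (fun x => 'D_v f x)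
   else True).

Definition smooth_real (R : realType) (V : normedModType R) (f : V -> R) : Prop :=
  forall k, Ck k f.

Definition smooth_mx (R : realType) (V : normedModType R) (m p : nat)
    (F : V -> 'M[R[i]]_(m, p)) : Prop :=
  forall i j, smooth_real (fun x => complex.Re (F x i j)) /\
              smooth_real (fun x => complex.Im (F x i j)).

Definition plane (R : realType) (p : R * R) : R[i] := p.1 +i* p.2.

Definition smooth (R : realType) (m p : nat)
    (F : R[i] -> 'M[R[i]]_(m, p)) : Prop :=
  smooth_mx (fun q : R * R => F (plane q)).

(* Real directional derivative along [v], computed entrywise on real and
   imaginary parts. *)
Definition dir_deriv (R : realType) (m p : nat) (v : R * R)
    (F : R[i] -> 'M[R[i]]_(m, p)) (z : R[i]) : 'M[R[i]]_(m, p) :=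
  \matrix_(i, j)
    ('D_v (fun q : R * R => complex.Re (F (plane q) i j))
          (complex.Re z, complex.Im z)
     +i* 'D_v (fun q : R * R => complex.Im (F (plane q) i j))
          (complex.Re z, complex.Im z)).

Definition dz (R : realType) (m p : nat)
    (F : R[i] -> 'M[R[i]]_(m, p)) (z : R[i]) : 'M[R[i]]_(m, p) :=
  2^-1 *: (dir_deriv (1, 0) F z - (0 +i* 1) *: dir_deriv (0, 1) F z).

Definition dzbar (R : realType) (m p : nat)
    (F : R[i] -> 'M[R[i]]_(m, p)) (z : R[i]) : 'M[R[i]]_(m, p) :=
  2^-1 *: (dir_deriv (1, 0) F z + (0 +i* 1) *: dir_deriv (0, 1) F z).

(* The torus T^2 is C / (Z w1 + Z w2); objects on it are given by their periodic
   lifts to the universal cover C. *)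
Definition lattice_basis (R : realType) (w1 w2 : R[i]) : Prop :=
  forall a b : R, a%:C * w1 + b%:C * w2 = 0 -> a = 0 /\ b = 0.

Definition periodic (R : realType) (T : Type) (w1 w2 : R[i]) (f : R[i] -> T) :
    Prop :=
  forall z, f (z + w1) = f z /\ f (z + w2) = f z.

(* A point of G_k(C^n) is encoded by the matrix of the orthogonal projection
   onto it, acting on column vectors; this encoding is a smooth embedding. *)
Definition grassmannian (R : realType) (n k : nat) (P : 'M[R[i]]_n) : Prop :=
  [/\ P *m P = P, P ^t* = P & \rank P = k].

(* Smooth maps T^2 -> G_k(C^n), equivalently rank-k subbundles of T^2 x C^n. *)
Definition subbundle (R : realType) (n : nat) (w1 w2 : R[i]) (k : nat)
    (alpha : R[i] -> 'M[R[i]]_n) : Prop :=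
  [/\ smooth alpha, periodic w1 w2 alpha & forall z, grassmannian k (alpha z)].

Definition is_section (R : realType) (n : nat) (w1 w2 : R[i])
    (alpha : R[i] -> 'M[R[i]]_n) (s : R[i] -> 'cV[R[i]]_n) : Prop :=
  [/\ smooth s, periodic w1 w2 s & forall z, alpha z *m s z = s z].

Definition cartan (R : realType) (n : nat) (alpha : R[i] -> 'M[R[i]]_n)
    (z : R[i]) : 'M[R[i]]_n :=
  alpha z - (1%:M - alpha z).

Definition Az (R : realType) (n : nat) (phi : R[i] -> 'M[R[i]]_n) (z : R[i]) :
    'M[R[i]]_n :=
  2^-1 *: (invmx (phi z) *m dz phi z).

Definition Azbar (R : realType) (n : nat) (phi : R[i] -> 'M[R[i]]_n)
    (z : R[i]) : 'M[R[i]]_n :=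
  2^-1 *: (invmx (phi z) *m dzbar phi z).

(* The last equation is, up to a constant factor, d^*(phi^{-1} dphi) = 0, i.e. the
   vanishing of the tension field of [phi] for the bi-invariant metric of U(n);
   by conformal invariance the flat metric |dz|^2 can be used on the domain. *)
Definition harmonic_map (R : realType) (n : nat) (phi : R[i] -> 'M[R[i]]_n) : Prop :=
  [/\ smooth phi,
      forall z, phi z \is unitarymx &
      forall z, dzbar (Az phi) z + dz (Azbar phi) z = 0].

Definition uniton (R : realType) (n : nat) (w1 w2 : R[i])
    (phi alpha : R[i] -> 'M[R[i]]_n) : Prop :=
  [/\ harmonic_map phi,
      exists k, subbundle w1 w2 k alpha &
      forall s, is_section w1 w2 alpha s ->
        is_section w1 w2 alpha (fun z => dzbar s z + Azbar phi z *m s z) /\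
        is_section w1 w2 alpha (fun z => Az phi z *m s z)].

Fixpoint uniton_product (R : realType) (n : nat) (phi0 : 'M[R[i]]_n)
    (alpha : nat -> R[i] -> 'M[R[i]]_n) (s : nat) (z : R[i]) : 'M[R[i]]_n :=
  if s is s'.+1 then uniton_product phi0 alpha s' z *m cartan (alpha s') z
  else phi0.

Definition finite_uniton_number (R : realType) (n : nat) (w1 w2 : R[i])
    (phi : R[i] -> 'M[R[i]]_n) : Prop :=
  exists (s : nat) (phi0 : 'M[R[i]]_n) (alpha : nat -> R[i] -> 'M[R[i]]_n),
    [/\ phi0 \is unitarymx,
        forall i, (i < s)%N ->
          uniton w1 w2 (uniton_product phi0 alpha i) (alpha i) &
        forall z, phi z = uniton_product phi0 alpha s z].

Definition circle (R : realType) : Type := {l : R[i] | `|l| == 1}.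

Lemma norm_cis (R : realType) (t : R) : `|cos t +i* sin t| == 1 :> R[i].
Proof. by rewrite normc_def /= cos2Dsin2 sqrtr1. Qed.

Definition cis (R : realType) (t : R) : circle R :=
  exist _ (cos t +i* sin t) (norm_cis t).

Definition extended_solution (R : realType) (n : nat)
    (Phi : circle R -> R[i] -> 'M[R[i]]_n) : Prop :=
  [/\ smooth_mx (fun q : R * (R * R) => Phi (cis q.1) (plane q.2)),
      forall l z, Phi l z \is unitarymx,
      forall (l : circle R) z, val l = 1 -> Phi l z = 1%:M &
      exists A B : R[i] -> 'M[R[i]]_n, forall l z,
        invmx (Phi l z) *m dz (Phi l) z = (1 - (val l)^-1) *: A z /\
        invmx (Phi l z) *m dzbar (Phi l) z = (1 - val l) *: B z].

Definition associated (R : realType) (n : nat)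
    (Phi : circle R -> R[i] -> 'M[R[i]]_n) (phi : R[i] -> 'M[R[i]]_n) : Prop :=
  exists2 u : 'M[R[i]]_n, u \is unitarymx &
    forall (l : circle R) z, val l = -1 -> Phi l z = u *m phi z.

Definition square_integrable (R : realType) (f : R -> R) : Prop :=
  measurable_fun `[0, 2 * pi] f /\
  (@lebesgue_measure R).-integrable `[0, 2 * pi] (fun t => ((f t) ^+ 2)%:E).

(* Functions representing elements of L^2(S^1, C^n). *)
Definition L2 (R : realType) (n : nat) : set (circle R -> 'cV[R[i]]_n) :=
  [set f : circle R -> 'cV[R[i]]_n | forall j,
     square_integrable (fun t => complex.Re (f (cis t) j 0)) /\
     square_integrable (fun t => complex.Im (f (cis t) j 0))].

(* k-th Fourier coefficient (1 / 2 pi) \int_0^{2 pi} f(e^{it}) e^{-ikt} dt. *)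
Definition fourier (R : realType) (n : nat) (f : circle R -> 'cV[R[i]]_n)
    (k : int) : 'cV[R[i]]_n :=
  \col_j
    (((2 * pi)^-1)%:C *
     ((\int[@lebesgue_measure R]_(t in `[0, 2 * pi])
         complex.Re (f (cis t) j 0 * (val (cis t)) ^ (- k)))%R
      +i* (\int[@lebesgue_measure R]_(t in `[0, 2 * pi])
         complex.Im (f (cis t) j 0 * (val (cis t)) ^ (- k)))%R)).

Definition Hplus (R : realType) (n : nat) : set (circle R -> 'cV[R[i]]_n) :=
  [set f : circle R -> 'cV[R[i]]_n |
     L2 f /\ forall k : int, k < 0 -> fourier f k = 0].

(* gamma H_+, for a continuous loop gamma of invertible matrices.  Among Borel
   functions, [Hplus] is closed under almost everywhere equality, hence so is
   this set, and equality of such sets of representatives is equality of the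
   corresponding subspaces of L^2(S^1, C^n). *)
Definition loop_Hplus (R : realType) (n : nat) (gamma : circle R -> 'M[R[i]]_n) :
    set (circle R -> 'cV[R[i]]_n) :=
  [set (fun l => gamma l *m f l) | f in @Hplus R n].

Definition expmx (R : realType) (n : nat) (A : 'M[R[i]]_n) : 'M[R[i]]_n :=
  \matrix_(i, j)
    (limn (series (fun k => complex.Re (((k`!)%:R^-1 *: A ^+ k) i j)) : nat -> R)
     +i* limn (series (fun k => complex.Im (((k`!)%:R^-1 *: A ^+ k) i j)) :
           nat -> R)).

(* \sum_(k = -1)^d xi_k l^k, with k = j - 1. *)
Definition laurent (R : realType) (n d : nat) (xi : int -> 'M[R[i]]_n)
    (l : circle R) : 'M[R[i]]_n :=
  \sum_(j < d.+2) (val l) ^ (j%:Z - 1) *: xi (j%:Z - 1).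

Definition finite_type (R : realType) (n : nat) (phi : R[i] -> 'M[R[i]]_n) :
    Prop :=
  exists (Phi : circle R -> R[i] -> 'M[R[i]]_n) (d : nat)
         (xi : int -> 'M[R[i]]_n),
    [/\ extended_solution Phi, associated Phi phi &
        forall z, loop_Hplus (fun l => Phi l z) =
                  loop_Hplus (fun l => expmx (z *: laurent d xi l))].

(* Main.v *)
(* Multiplying the factors [pi_i + l (1 - pi_i)] of a uniton factorization gives an
   extended solution Psi which is periodic in z and a Laurent polynomial in l.  Two
   extended solutions of the same map differ by a factor independent of z, so the
   extended solution Phi with W(z) = exp(xi z) H_+ satisfies
   Phi(0)^* Phi(z) = Psi(0)^* Psi(z); in particular it is periodic, and
   exp(xi w) H_+ = H_+ for every lattice point w.  Hence the l^(-1) coefficient of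
   exp(xi z), an entire function of z of exponential type with derivative xi_(-1) at
   0, vanishes on the whole lattice.  A lattice has too many points for this, by
   Jensen's argument, so xi_(-1) = 0.  Then xi is polynomial in l and
   exp(xi z) H_+ = H_+ for all z, hence both Phi(0)^* Phi(z) and its adjoint
   preserve H_+: this Laurent polynomial is constant in l, equal to its value 1 at
   l = 1. *)

Require Import Defs.
From mathcomp Require Import all_boot all_order all_algebra.
From mathcomp Require Import complex spectral sesquilinear.
From mathcomp Require Import all_classical all_reals all_analysis.
From mathcomp Require Import measurable_realfun.
From mathcomp Require Import ring lra.

Set Implicit Arguments.
Unset Strict Implicit.
Unset Printing Implicit Defensive.

Import Order.TTheory GRing.Theory Num.Theory.
Import numFieldNormedType.Exports.

Local Open Scope classical_set_scope.
Local Open Scope complex_scope.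
Local Open Scope sesquilinear_scope.
Local Open Scope ring_scope.

(** Jensen's argument is carried out on coefficient sequences: an entire function is its Taylor
    series, division by z - a is a recursion on coefficients, and the maximum modulus on a disc is
    replaced by a weighted l1 norm. In general exp(xi z) is not unitary, so Phi(z) differs from it
    and the two communicate only through equalities of subspaces. These equalities are tested on
    constant vectors, which lie in H_+. For unitary maps the derivative in zbar is determined by the
    derivative in z, so every differential equation is followed in its z-half only. The Laurent form
    of Phi(0)^* Phi(z), inherited from Psi, matters at the end: the conclusion concerns the single
    point l = -1, while membership in H_+ is a statement about integrals over the circle. For a
    Laurent polynomial the vanishing of Fourier coefficients is vanishing of its actual
    coefficients, which reaches every point. *)

Section Modulus.
Variable R : realType.
Implicit Types (x y : R[i]).

(** In [R[i]] the norm [|x|] is itself a complex number; limits, [lra] and [nra] call for a modulus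
    with values in [R]. *)
Definition modc x : R := Normc.normc x.

Lemma normE_modc x : `|x| = (modc x)%:C.
Proof. by case: x. Qed.

Lemma modc_ge0 x : 0 <= modc x.
Proof. by rewrite -lecR -normE_modc normr_ge0. Qed.

Lemma modcM x y : modc (x * y) = modc x * modc y.
Proof. exact: Normc.normcM. Qed.

Lemma modcV x : modc x^-1 = (modc x)^-1.
Proof. exact: Normc.normcV. Qed.

Lemma modc0 : modc 0 = 0.
Proof. exact: Normc.normc0. Qed.

Lemma modc1 : modc 1 = 1.
Proof. exact: Normc.normc1. Qed.

Lemma modcN x : modc (- x) = modc x.
Proof. exact: normcN. Qed.

Lemma ler_modcD x y : modc (x + y) <= modc x + modc y.
Proof. exact: le_normcD. Qed.

Lemma modc_distC x y : modc (x - y) = modc (y - x).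
Proof. by rewrite -modcN opprB. Qed.

Lemma ler_modcB x y : modc (x - y) <= modc x + modc y.
Proof. by rewrite (le_trans (ler_modcD _ _))// modcN. Qed.

Lemma modc_eq0 x : (modc x == 0) = (x == 0).
Proof.
by apply/eqP/eqP => [/Normc.eq0_normc//|->]; exact: modc0.
Qed.

Lemma modc_gt0 x : (0 < modc x) = (x != 0).
Proof. by rewrite lt_def modc_ge0 modc_eq0 andbT. Qed.

Lemma modcX x n : modc (x ^+ n) = modc x ^+ n.
Proof.
by elim: n => [|n IH]; rewrite ?expr0 ?modc1// !exprS modcM IH.
Qed.

Lemma ler_modc_sum (I : Type) (r : seq I) (P : pred I) (F : I -> R[i]) :
  modc (\sum_(i <- r | P i) F i) <= \sum_(i <- r | P i) modc (F i).
Proof.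
elim/big_rec2 : _ => [|i y x _ yx]; first by rewrite modc0.
by rewrite (le_trans (ler_modcD _ _))// lerD2l.
Qed.

Lemma modc_real (r : R) : modc r%:C = `|r|.
Proof. by rewrite /modc /= expr0n addr0 sqrtr_sqr. Qed.

Lemma modc_Re x : `|complex.Re x| <= modc x.
Proof. by rewrite -lecR -normE_modc normc_ge_Re. Qed.

Lemma modc_Im x : `|complex.Im x| <= modc x.
Proof.
case: x => a b /=; rewrite -sqrtr_sqr ler_wsqrtr//.
by rewrite lerDr sqr_ge0.
Qed.

Lemma modc_le x : modc x <= `|complex.Re x| + `|complex.Im x|.
Proof.
case: x => a b /=; rewrite -(ler_pXn2r (ltn0Sn 1)) ?nnegrE ?sqrtr_ge0 ?addr_ge0//.
rewrite sqr_sqrtr ?addr_ge0 ?sqr_ge0// sqrrD !real_normK ?num_real//.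
by rewrite lerD2r lerDl mulrn_wge0// mulr_ge0.
Qed.

End Modulus.

(** * Zeros of entire functions of exponential type *)

Section ZerosOfEntireSeries.
Variable R : realType.
Implicit Types (f : nat -> R[i]) (a b : R[i]) (r B : R).

Definition pser f a (n : nat) : R[i] := \sum_(k < n) f k * a ^+ k.

Definition pser_vanishes f a := modc (pser f a n) @[n --> \oo] --> (0 : R).

(* The weighted l1 norm [\sum_k |f_k| r^k] is at most [B]. *)
Definition wnorm_le f r B := forall n, \sum_(k < n) modc (f k) * r ^+ k <= B.

(* The quotient [f / (z - a)] when [f] vanishes at [a]: its k-th coefficient
   [\sum_(j > k) f_j a^(j - k - 1)] is then minus a partial sum of [f a]. *)
Definition pquo f a (k : nat) : R[i] := - pser f a k.+1 / a ^+ k.+1.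

Lemma pserS f a n : pser f a n.+1 = pser f a n + f n * a ^+ n.
Proof. by rewrite /pser big_ord_recr. Qed.

Lemma pser0 f a : pser f a 0 = 0.
Proof. by rewrite /pser big_ord0. Qed.

Lemma pquo0 f a : a != 0 -> f 0%N = - a * pquo f a 0.
Proof. by move=> a0; rewrite /pquo pserS pser0 expr0; field. Qed.

Lemma pquoS f a k : a != 0 -> f k.+1 = pquo f a k - a * pquo f a k.+1.
Proof.
move=> a0; rewrite /pquo [pser f a k.+2]pserS (exprS a k.+1).
have ak0 : a ^+ k.+1 != 0 by rewrite expf_neq0.
move: (a ^+ k.+1) ak0 => q q0.
by field; rewrite a0 q0.
Qed.

(** The factorization f(b) = (b - a) q(b) for truncated series: the recursion f_(k+1) = q_k - a
    q_(k+1) telescopes up to a boundary term, which has to be sent to 0 later. *)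
Lemma pser_pquo f a b n : a != 0 ->
  pser f b n.+1 = (b - a) * pser (pquo f a) b n - a * pquo f a n * b ^+ n.
Proof.
move=> a0; elim: n => [|n IH].
  by rewrite pserS !pser0 expr0 (pquo0 f a0); ring.
by rewrite pserS IH (pquoS f n a0) (pserS (pquo f a)) exprS; ring.
Qed.

(** Since q_k = f_(k+1) + a q_(k+1), summing |q_k| r^(k+1) gives the norm of f plus |a| times a
    shifted sum of the same kind. Moving that sum to the left leaves one error term, at index K. *)
Lemma wnorm_pquo_partial f a r K : a != 0 -> 0 <= r ->
  (r - modc a) * (\sum_(k < K) modc (pquo f a k) * r ^+ k) <=
  \sum_(k < K.+1) modc (f k) * r ^+ k + modc a * modc (pquo f a K) * r ^+ K.
Proof.
move=> a0 r0; elim: K => [|K IH].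
  rewrite big_ord0 mulr0 big_ord1 expr0 !mulr1 addr_ge0 ?modc_ge0//.
  by rewrite mulr_ge0 ?modc_ge0.
have fK : modc (pquo f a K) <= modc (f K.+1) + modc a * modc (pquo f a K.+1).
  by rewrite -modcM (le_trans _ (ler_modcD _ _))// (pquoS f K a0) subrK.
have {}fK := ler_wpM2r (exprn_ge0 K.+1 r0) fK.
rewrite big_ord_recr /= [in leRHS]big_ord_recr /=.
move: IH fK; rewrite exprS; nra.
Qed.

(** If f(a) = 0, a partial sum at a is minus the tail, and the tail absorbs the weight: |a|^m
    (r/|a|)^K <= r^m for m >= K. This finite form keeps one far partial sum, which tends to 0 with
    n. *)
Lemma modc_pser_tail f a r K n : a != 0 -> modc a <= r ->
  modc (pser f a K.+1) * (r / modc a) ^+ K <=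
  \sum_(K.+1 <= k < K.+1 + n) modc (f k) * r ^+ k +
  modc (pser f a (K.+1 + n)) * (r / modc a) ^+ K.
Proof.
move=> a0 ar; have a_gt0 : 0 < modc a by rewrite modc_gt0.
have r0 : 0 <= r by rewrite (le_trans (ltW a_gt0)).
elim: n => [|n IH]; first by rewrite addn0 big_geq// add0r.
apply: le_trans IH _; rewrite addnS [in leRHS]big_nat_recr ?leq_addr//= -addrA lerD2l.
set m := (K.+1 + n)%N; set q := (r / modc a) ^+ K.
have q0 : 0 <= q by rewrite exprn_ge0// divr_ge0// ltW.
have fm : modc (pser f a m) <= modc (f m) * modc a ^+ m + modc (pser f a m.+1).
  have -> : pser f a m = pser f a m.+1 - f m * a ^+ m by rewrite pserS addrK.
  by rewrite -modcX -modcM [leRHS]addrC ler_modcB.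
apply: le_trans (ler_wpM2r q0 fm) _; rewrite mulrDl lerD2r -mulrA.
rewrite ler_wpM2l ?modc_ge0//.
have Em : (m = n.+1 + K)%N by rewrite /m addnC addSnnS.
have -> : modc a ^+ m * q = modc a ^+ n.+1 * r ^+ K.
  rewrite /q expr_div_n Em exprD; move: (modc a ^+ n.+1) => u.
  have : modc a ^+ K != 0 by rewrite expf_neq0 ?gt_eqF.
  by move: (modc a ^+ K) => v v0; field.
by rewrite Em exprD ler_wpM2r ?exprn_ge0// lerXn2r ?nnegrE// ltW.
Qed.

(* This bound plays the role of the maximum modulus principle in Jensen's
   zero-counting argument. *)
Lemma wnorm_pquo f a r B : a != 0 -> modc a < r ->
  pser_vanishes f a -> wnorm_le f r B -> wnorm_le (pquo f a) r (B / (r - modc a)).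
Proof.
move=> a0 ar fa fB K; have a_gt0 : 0 < modc a by rewrite modc_gt0.
have r0 : 0 < r by rewrite (lt_trans a_gt0).
rewrite ler_pdivlMr ?subr_gt0// mulrC.
set q := (r / modc a) ^+ K.
(* The two blocks of |f_k| r^k, up to index K and from K + 1 on, join into a single sum bounded by
   [B]. What remains tends to 0 as n grows with K fixed. *)
have bnd n : (r - modc a) * (\sum_(k < K) modc (pquo f a k) * r ^+ k) <=
    B + modc (pser f a (n + K.+1)) * q.
  apply: le_trans (wnorm_pquo_partial _ _ a0 (ltW r0)) _.
  have -> : modc a * modc (pquo f a K) * r ^+ K = modc (pser f a K.+1) * q.
    rewrite /pquo modcM modcN modcV modcX /q expr_div_n exprS.
    by field; rewrite expf_neq0 ?gt_eqF.
  have tl := modc_pser_tail f K n a0 (ltW ar).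
  apply: le_trans (lerD (lexx _) tl) _.
  rewrite addrA [(n + _)%N]addnC lerD2r.
  have := fB (K.+1 + n)%N.
  rewrite -(big_mkord xpredT (fun k => modc (f k) * r ^+ k)).
  by rewrite (@big_cat_nat _ _ _ K.+1) ?leq_addr//= big_mkord.
have lim : B + modc (pser f a (n + K.+1)) * q @[n --> \oo] --> B.
  rewrite -[X in _ --> X]addr0; apply: cvgD; first exact: cvg_cst.
  rewrite -(mul0r q); apply: cvgMl.
  by rewrite (cvg_shiftn K.+1 (fun n => modc (pser f a n))).
by apply: (cvgr_to_ge lim); near=> n; exact: bnd.
Unshelve. all: by end_near.
Qed.

Lemma wnorm_le_term f r B n : 0 <= r -> wnorm_le f r B -> modc (f n) * r ^+ n <= B.
Proof.
move=> r0 /(_ n.+1); rewrite big_ord_recr /=; apply: le_trans.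
by rewrite lerDr sumr_ge0// => k _; rewrite mulr_ge0 ?modc_ge0 ?exprn_ge0.
Qed.

(** Dividing [pser_pquo] by b - a leaves the partial sum of f at b and the boundary term. The latter
    is O((|b|/r)^n), because [wnorm_pquo] bounds |q_n| r^n. *)
Lemma pser_vanishes_pquo f a b r B : a != 0 -> b != a -> modc a < r ->
  modc b < r -> wnorm_le f r B -> pser_vanishes f a -> pser_vanishes f b ->
  pser_vanishes (pquo f a) b.
Proof.
move=> a0 ba ar br fB fa fb; have hB := wnorm_pquo a0 ar fa fB.
have r0 : 0 < r by rewrite (le_lt_trans (modc_ge0 a)).
have d0 : 0 < modc (b - a) by rewrite modc_gt0 subr_eq0.
set B' := B / _ in hB.
pose u n := (modc (b - a))^-1 *
  (modc (pser f b n.+1) + modc a * (B' * (modc b / r) ^+ n)).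
have bnd n : 0 <= modc (pser (pquo f a) b n) <= u n.
  rewrite modc_ge0 /= /u ler_pdivlMl// -modcM.
  have -> : (b - a) * pser (pquo f a) b n =
            pser f b n.+1 + a * pquo f a n * b ^+ n by rewrite (pser_pquo f b n a0) subrK.
  apply: le_trans (ler_modcD _ _) _.
  rewrite lerD2l -mulrA modcM (modcM (pquo _ _ _)) modcX.
  rewrite ler_wpM2l ?modc_ge0//.
  have -> : modc b ^+ n = r ^+ n * (modc b / r) ^+ n.
    by rewrite -exprMn mulrCA divff ?gt_eqF// mulr1.
  rewrite mulrA ler_wpM2r ?exprn_ge0 ?divr_ge0 ?modc_ge0 ?(ltW r0)//.
  exact: (wnorm_le_term n (ltW r0) hB).
have lim_u : u n @[n --> \oo] --> (modc (b - a))^-1 * (0 + modc a * (B' * 0)).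
  apply: cvgMr; apply: cvgD; first by rewrite (cvg_shiftS (fun n => modc (pser f b n))).
  apply: cvgMr; apply: cvgMr; apply: cvg_expr.
  by rewrite ger0_norm ?divr_ge0 ?modc_ge0 ?(ltW r0)// ltr_pdivrMr ?mul1r.
rewrite !mulr0 addr0 mulr0 in lim_u.
apply: squeeze_cvgr lim_u; last exact: cvg_cst.
by near=> n; exact: bnd.
Unshelve. all: by end_near.
Qed.

(** Dividing out a zero a divides the modulus of the constant coefficient by |a|, but multiplies the
    norm bound only by 1/(r - |a|). As 4|a| <= r, the ratio (r - |a|)/|a| is at least 3, so each
    zero gains a factor 3. *)
Lemma modc_coef0_le f r B (s : seq R[i]) : uniq s ->
  (forall a, a \in s -> [/\ a != 0, 4 * modc a <= r & pser_vanishes f a]) ->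
  wnorm_le f r B -> modc (f 0%N) * 3 ^+ size s <= B.
Proof.
elim: s f B => [|a s IH] f B /= => [_ _ /(_ 1%N)|/andP[as_ us] fs fB].
  by rewrite big_ord1 expr0.
have [a0 ar fa] := fs a (mem_head _ _).
have a_gt0 : 0 < modc a by rewrite modc_gt0.
have ar' : modc a < r by lra.
have hB := wnorm_pquo a0 ar' fa fB.
have {IH} : modc (pquo f a 0) * 3 ^+ size s <= B / (r - modc a).
  apply: IH => // b bs; have bs' : b \in a :: s by rewrite in_cons bs orbT.
  have [b0 br fb] := fs b bs'; split => //.
  have b_gt0 : 0 < modc b by rewrite modc_gt0.
  have br' : modc b < r by lra.
  apply: (pser_vanishes_pquo (r := r) (B := B)) => //.
  by apply: contraNneq as_ => <-.
rewrite ler_pdivlMr ?subr_gt0// (pquo0 f a0) (modcM (- a)) modcN exprS => H.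
apply: le_trans H.
have := modc_ge0 (pquo f a 0); have : 0 <= 3 ^+ size s :> R by rewrite exprn_ge0.
set u := modc (pquo _ _ _); set v := _ ^+ _ => v0 u0.
(* This is 3|a| <= r - |a|, scaled by the nonnegative product [u * v]. *)
have : 0 <= u * v * (r - 4 * modc a) by rewrite !mulr_ge0// subr_ge0.
lra.
Qed.

End ZerosOfEntireSeries.

(** * Functions of exponential type vanishing on a lattice *)

Section ExponentialType.
Variable R : realType.

Lemma expR_partial_le (x : R) n : 0 <= x ->
  \sum_(k < n) x ^+ k / k`!%:R <= expR x.
Proof.
move=> x0; rewrite -(big_mkord xpredT (fun k => x ^+ k / k`!%:R)).
apply: (nondecreasing_cvgn_le _ (is_cvg_series_exp_coeff x)).
apply: nondecreasing_series => k _ _.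
by rewrite /exp_coeff /= divr_ge0 ?exprn_ge0.
Qed.

Lemma lattice_points_inj (w1 w2 : R[i]) : lattice_basis w1 w2 ->
  injective (fun p : nat * nat => p.1%:R * w1 + p.2%:R * w2).
Proof.
move=> hw [a1 a2] [b1 b2] /= /eqP; rewrite -subr_eq0 => /eqP E.
have [] := hw (a1%:R - b1%:R) (a2%:R - b2%:R).
  rewrite !rmorphB /= !rmorph_nat -[RHS]E; ring.
by move=> /eqP + /eqP; rewrite !subr_eq0 !eqr_nat => /eqP -> /eqP ->.
Qed.

Lemma modc_nat n : modc (n%:R : R[i]) = n%:R.
Proof. by rewrite -[n%:R](rmorph_nat (real_complex R)) modc_real normr_nat. Qed.

(** Divides out the zero at the origin, which [pquo] cannot do since it divides by powers of the
    zero. *)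
Lemma pser_shift (f : nat -> R[i]) a n : a != 0 -> f 0%N = 0 ->
  pser (fun k => f k.+1) a n = a^-1 * pser f a n.+1.
Proof.
move=> a0 f0; elim: n => [|n IH]; first by rewrite pserS !pser0 f0 mul0r addr0 mulr0.
by rewrite pserS IH [in RHS]pserS mulrDr exprS; congr (_ + _); field.
Qed.

(* The lattice has about M^2 points in a disc of radius O(M); dividing them out of
   the series gives c 1 = O(e^(O(M)) 3^(-M^2)) for every M. *)
Lemma exp_type_lattice_zeros (c : nat -> R[i]) (K C : R) (w1 w2 : R[i]) :
  0 <= K -> 0 <= C -> (forall k, modc (c k) <= K * C ^+ k) ->
  lattice_basis w1 w2 ->
  (forall m1 m2 : nat, pser_vanishes (fun k => c k / k`!%:R)
     (m1%:R * w1 + m2%:R * w2)) ->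
  c 1%N = 0.
Proof.
move=> K0 C0 cK hw fz; pose f k := c k / k`!%:R; pose g k := f k.+1.
(* The origin is a lattice point, and there every nonempty partial sum equals the constant
   coefficient. *)
have f0 : f 0%N = 0.
  apply/eqP; rewrite -modc_eq0 eq_le modc_ge0 andbT.
  have := fz 0%N 0%N; rewrite !mul0r addr0 => h; apply: (cvgr_to_ge h).
  exists 1%N => //= n /= n0; rewrite -(prednK n0) /pser big_ord_recl expr0 mulr1.
  by rewrite big1 ?addr0// => k _; rewrite expr0n mulr0.
have gz a : a != 0 -> pser_vanishes f a -> pser_vanishes g a.
  move=> a0 fa; rewrite /pser_vanishes.
  have -> : (fun n => modc (pser g a n)) =
      (fun n => modc a^-1 * modc (pser f a n.+1)).
    by apply/funext => n; rewrite /g pser_shift// modcM.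
  rewrite -(mulr0 (modc a^-1)); apply: cvgMr.
  by rewrite (cvg_shiftS (fun n => modc (pser f a n))).
have gB r : 0 <= r -> wnorm_le g r (K * C * expR (C * r)).
  move=> r0 n; have Cr0 : 0 <= C * r by rewrite mulr_ge0.
  apply: le_trans (ler_wpM2l (mulr_ge0 K0 C0) (expR_partial_le n Cr0)).
  rewrite big_distrr /=; apply: ler_sum => k _.
  rewrite /g /f modcM modcV modc_nat exprMn.
  have k0 : 0 < k`!%:R :> R by rewrite ltr0n fact_gt0.
  have k1 : 0 < (k.+1)`!%:R :> R by rewrite ltr0n fact_gt0.
  have -> : K * C * (C ^+ k * r ^+ k / k`!%:R) = (K * C ^+ k.+1 / k`!%:R) * r ^+ k.
    by rewrite exprS; field; rewrite gt_eqF.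
  rewrite ler_wpM2r ?exprn_ge0// ler_pM ?modc_ge0 ?invr_ge0 ?(ltW k1)//.
  by rewrite lef_pV2 ?posrE// ler_nat factS leq_pmull.
set w := modc w1 + modc w2.
have w0 : 0 <= w by rewrite addr_ge0 ?modc_ge0.
have key M : modc (c 1%N) * 3 ^+ (M * M) <= K * C * expR (4 * C * w) ^+ M.
  (* Both coefficients run from 1 to M, which keeps the origin out. Each point has modulus at most M
     w, so the radius 4 M w meets the condition 4|a| <= r. *)
  pose s := [seq p.1%:R * w1 + p.2%:R * w2 |
    p <- [seq (a, b) | a <- iota 1 M, b <- iota 1 M]].
  have us : uniq s.
    rewrite map_inj_uniq; last exact: lattice_points_inj.
    by apply: allpairs_uniq; rewrite ?iota_uniq// => -[? ?] [? ?] _ _ [-> ->].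
  have r0 : 0 <= 4 * (M%:R * w) by rewrite !mulr_ge0.
  have := modc_coef0_le us _ (gB _ r0).
  rewrite size_map size_allpairs !size_iota /g (_ : f 1%N = c 1%N); last exact: divr1.
  rewrite -expRM_natl.
  have -> : C * (4 * (M%:R * w)) = M%:R * (4 * C * w) by ring.
  apply => a /mapP[[p q]] /allpairsP[[p' q']] /= [].
  rewrite !mem_iota => /andP[p0 pM] /andP[q0 qM] [-> ->] ->; split.
  - apply/eqP => E; have [] := hw p'%:R q'%:R.
      by rewrite !rmorph_nat.
    by move/eqP; rewrite pnatr_eq0; case: p' p0 {pM E}.
  - rewrite ler_wpM2l//; apply: le_trans (ler_modcD _ _) _.
    rewrite !modcM !modc_nat /w mulrDr lerD// ler_wpM2r ?modc_ge0// ler_nat.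
      by rewrite -ltnS -add1n.
    by rewrite -ltnS -add1n.
  - apply: gz (fz p' q'); apply/eqP => E; have [] := hw p'%:R q'%:R.
      by rewrite !rmorph_nat.
    by move/eqP; rewrite pnatr_eq0; case: p' p0 {pM E}.
set q := expR _ in key.
have q0 : 0 <= q by exact: expR_ge0.
(* Take M = t + L with 3^L >= q: the factor 3^(L M) absorbs q^M, leaving |c_1| 3^(t M) <= K C. A
   bound linear in t is enough to conclude. *)
have [L qL] : exists L : nat, q <= 3 ^+ L.
  exists (Num.Def.archi_bound q); apply: le_trans (ltW (archi_boundP q0)) _.
  by rewrite -natrX ler_nat ltnW// ltn_expl.
have KC0 : 0 <= K * C by rewrite mulr_ge0.
have key2 t : modc (c 1%N) * t%:R <= K * C.
  have := key (t + L)%N.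
  have -> : ((t + L) * (t + L) = t * (t + L) + L * (t + L))%N by rewrite mulnDl.
  rewrite exprD mulrA => H.
  have {}H : modc (c 1%N) * 3 ^+ (t * (t + L)) <= K * C.
    rewrite -(ler_pM2r (_ : 0 < 3 ^+ (L * (t + L)))) ?exprn_gt0//.
    apply: le_trans H _; rewrite ler_wpM2l// exprM lerXn2r ?nnegrE ?exprn_ge0//.
  apply: le_trans H; rewrite ler_wpM2l ?modc_ge0//.
  rewrite -natrX ler_nat; case: t => // t.
  apply: leq_trans (ltnW (ltn_expl _ _)) _ => //.
  by rewrite leq_exp2l// leq_pmulr// addSn.
apply/eqP; rewrite -modc_eq0 eq_le modc_ge0 andbT leNgt; apply/negP => c0.
have d0 : 0 <= K * C / modc (c 1%N) by rewrite divr_ge0// ltW.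
have := archi_boundP d0; rewrite ltr_pdivrMr// [ltRHS]mulrC ltNge => /negP; apply.
exact: key2.
Qed.

End ExponentialType.

(** * Fourier coefficients on the circle *)

Section ComplexIntegral.
Variable R : realType.
Local Notation mu := (@lebesgue_measure R).
Local Notation I := (`[0, 2 * pi]%classic : set R).
Implicit Types (g h : R -> R[i]) (G : R -> R).

Definition cmeasurable h :=
  measurable_fun I (fun t => complex.Re (h t)) /\
  measurable_fun I (fun t => complex.Im (h t)).

Definition cintegrable h :=
  mu.-integrable I (fun t => (complex.Re (h t))%:E) /\
  mu.-integrable I (fun t => (complex.Im (h t))%:E).

Definition csquare h :=
  square_integrable (fun t => complex.Re (h t)) /\
  square_integrable (fun t => complex.Im (h t)).

Definition cint h : R[i] :=
  (\int[mu]_(t in I) complex.Re (h t))%R +i*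
  (\int[mu]_(t in I) complex.Im (h t))%R.

(** This class preserves square integrability, is closed under sums and products, and contains the
    entries of Laurent loops and of their exponentials. *)
Definition cmultiplier g := cmeasurable g /\ exists B, forall t, modc (g t) <= B.

Lemma integrable_cst_period (c : R) : mu.-integrable I (fun=> c%:E).
Proof.
apply: (@continuous_compact_integrable R (fun=> c)); first exact: segment_compact.
by apply: continuous_subspaceT => x; exact: cvg_cst.
Qed.

Lemma le_integrable_fin (f G : R -> R) : measurable_fun I f ->
  (forall t, I t -> `|f t| <= G t) -> mu.-integrable I (EFin \o G) ->
  mu.-integrable I (EFin \o f).
Proof.
move=> mf fG iG; apply: le_integrable iG => //.
  exact/measurable_EFinP.
by move=> t It /=; rewrite lee_fin (le_trans (fG _ It))// ler_norm.
Qed.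

Lemma integrable_finD (f G : R -> R) : mu.-integrable I (EFin \o f) ->
  mu.-integrable I (EFin \o G) -> mu.-integrable I (EFin \o (fun t => f t + G t)).
Proof. by move=> h1 h2; exact: (@integrableD _ _ _ mu I _ _ _ h1 h2). Qed.

Lemma integrable_finZ (c : R) (f : R -> R) : mu.-integrable I (EFin \o f) ->
  mu.-integrable I (EFin \o (fun t => c * f t)).
Proof. by move=> h1; exact: (@integrableZl _ _ _ mu I _ c _ h1). Qed.

Lemma ReD (x y : R[i]) : complex.Re (x + y) = complex.Re x + complex.Re y.
Proof. by case: x y => [? ?] []. Qed.

Lemma ImD (x y : R[i]) : complex.Im (x + y) = complex.Im x + complex.Im y.
Proof. by case: x y => [? ?] []. Qed.

Lemma ReM (x y : R[i]) :
  complex.Re (x * y) = complex.Re x * complex.Re y - complex.Im x * complex.Im y.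
Proof. by case: x y => [? ?] []. Qed.

Lemma ImM (x y : R[i]) :
  complex.Im (x * y) = complex.Re x * complex.Im y + complex.Im x * complex.Re y.
Proof. by case: x y => [? ?] []. Qed.

Lemma cmeasurableD g h : cmeasurable g -> cmeasurable h ->
  cmeasurable (fun t => g t + h t).
Proof.
move=> [g1 g2] [h1 h2]; split.
  by under [X in measurable_fun _ X]eq_fun do rewrite ReD; exact: measurable_funD.
by under [X in measurable_fun _ X]eq_fun do rewrite ImD; exact: measurable_funD.
Qed.

Lemma cmeasurableM g h : cmeasurable g -> cmeasurable h ->
  cmeasurable (fun t => g t * h t).
Proof.
move=> [g1 g2] [h1 h2]; split.
  under [X in measurable_fun _ X]eq_fun do rewrite ReM.
  by apply: measurable_funB; exact: measurable_funM.
under [X in measurable_fun _ X]eq_fun do rewrite ImM.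
by apply: measurable_funD; exact: measurable_funM.
Qed.

Lemma cmeasurable_cst c : cmeasurable (fun=> c).
Proof. by split; exact: measurable_cst. Qed.

Lemma cintegrable_dom h G : cmeasurable h -> mu.-integrable I (EFin \o G) ->
  (forall t, I t -> modc (h t) <= G t) -> cintegrable h.
Proof.
move=> [h1 h2] iG hG; split; apply: le_integrable_fin iG => // t It;
  by apply: le_trans (hG t It); rewrite ?modc_Re ?modc_Im.
Qed.

Lemma csquare_dom h G : cmeasurable h -> mu.-integrable I (EFin \o G) ->
  (forall t, I t -> modc (h t) ^+ 2 <= G t) -> csquare h.
Proof.
move=> [h1 h2] iG hG; split; split => //; apply: le_integrable_fin iG.
- exact: measurable_funX.
- move=> t It; apply: le_trans (hG t It).
  rewrite ger0_norm ?sqr_ge0// -real_normK ?num_real//.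
  by rewrite lerXn2r ?nnegrE ?modc_ge0// modc_Re.
- exact: measurable_funX.
- move=> t It; apply: le_trans (hG t It).
  rewrite ger0_norm ?sqr_ge0// -real_normK ?num_real//.
  by rewrite lerXn2r ?nnegrE ?modc_ge0// modc_Im.
Qed.

Lemma csquare_measurable h : csquare h -> cmeasurable h.
Proof. by move=> [[h1 _] [h2 _]]. Qed.

Lemma modc_sqr (x : R[i]) : modc x ^+ 2 = complex.Re x ^+ 2 + complex.Im x ^+ 2.
Proof. by case: x => a b; rewrite sqr_sqrtr// addr_ge0 ?sqr_ge0. Qed.

Lemma integrable_modc_sqr h : csquare h ->
  mu.-integrable I (EFin \o (fun t => modc (h t) ^+ 2)).
Proof.
move=> [[_ h1] [_ h2]]; under [X in _.-integrable _ (_ \o X)]eq_fun do rewrite modc_sqr.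
exact: integrable_finD.
Qed.

(** Constants are integrable over the bounded period, and |h| <= 1 + |h|^2. *)
Lemma csquare_integrable h : csquare h -> cintegrable h.
Proof.
move=> h2; apply: (@cintegrable_dom _ (fun t => 1 + modc (h t) ^+ 2)).
- exact: csquare_measurable.
- by apply: integrable_finD (integrable_modc_sqr h2); exact: integrable_cst_period.
- move=> t _; have := sqr_ge0 (modc (h t) - 1); have := modc_ge0 (h t); nra.
Qed.

Lemma csquareM g h : cmultiplier g -> csquare h -> csquare (fun t => g t * h t).
Proof.
move=> [mg [B gB]] h2; apply: (@csquare_dom _ (fun t => B ^+ 2 * modc (h t) ^+ 2)).
- by apply: cmeasurableM => //; exact: csquare_measurable.
- by apply: integrable_finZ; exact: integrable_modc_sqr.
- move=> t _; rewrite modcM exprMn ler_wpM2r ?sqr_ge0//.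
  by rewrite lerXn2r ?nnegrE ?modc_ge0// (le_trans (modc_ge0 _) (gB t)).
Qed.

Lemma csquareD g h : csquare g -> csquare h -> csquare (fun t => g t + h t).
Proof.
move=> g2 h2.
apply: (@csquare_dom _ (fun t => 2 * modc (g t) ^+ 2 + 2 * modc (h t) ^+ 2)).
- by apply: cmeasurableD; exact: csquare_measurable.
- by apply: integrable_finD; apply: integrable_finZ; exact: integrable_modc_sqr.
- move=> t _; have H := ler_modcD (g t) (h t).
  apply: (@le_trans _ _ ((modc (g t) + modc (h t)) ^+ 2)).
    by rewrite lerXn2r ?nnegrE ?addr_ge0 ?modc_ge0.
  have := sqr_ge0 (modc (g t) - modc (h t)); nra.
Qed.

Lemma csquare_cst c : csquare (fun=> c).
Proof.
apply: (@csquare_dom _ (fun=> modc c ^+ 2)) => //.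
exact: integrable_cst_period.
Qed.

Lemma csquare_sum (J : Type) (r : seq J) (F : J -> R -> R[i]) :
  (forall j, csquare (F j)) -> csquare (fun t => \sum_(j <- r) F j t).
Proof.
move=> hF; elim: r => [|j r IH].
  by under [X in csquare X]eq_fun do rewrite big_nil; exact: csquare_cst.
by under [X in csquare X]eq_fun do rewrite big_cons; exact: csquareD.
Qed.

Lemma csquare_multiplier g : cmultiplier g -> csquare g.
Proof.
move=> mg; rewrite (_ : g = fun t => g t * 1); last by apply/funext => t; rewrite mulr1.
by apply: csquareM => //; exact: csquare_cst.
Qed.

Lemma cmultiplierM g h : cmultiplier g -> cmultiplier h ->
  cmultiplier (fun t => g t * h t).
Proof.
move=> [mg [B gB]] [mh [B' hB]]; split; first exact: cmeasurableM.
by exists (B * B') => t; rewrite modcM ler_pM ?modc_ge0.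
Qed.

Lemma cmultiplierD g h : cmultiplier g -> cmultiplier h ->
  cmultiplier (fun t => g t + h t).
Proof.
move=> [mg [B gB]] [mh [B' hB]]; split; first exact: cmeasurableD.
by exists (B + B') => t; rewrite (le_trans (ler_modcD _ _))// lerD.
Qed.

Lemma cmultiplier_cst c : cmultiplier (fun=> c).
Proof. by split; [exact: cmeasurable_cst | exists (modc c)]. Qed.

Lemma cmultiplier_sum (J : Type) (r : seq J) (F : J -> R -> R[i]) :
  (forall j, cmultiplier (F j)) -> cmultiplier (fun t => \sum_(j <- r) F j t).
Proof.
move=> hF; elim: r => [|j r IH].
  by under [X in cmultiplier X]eq_fun do rewrite big_nil; exact: cmultiplier_cst.
by under [X in cmultiplier X]eq_fun do rewrite big_cons; exact: cmultiplierD.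
Qed.

Lemma cintD g h : cintegrable g -> cintegrable h ->
  cint (fun t => g t + h t) = cint g + cint h.
Proof.
move=> [g1 g2] [h1 h2]; rewrite /cint.
under eq_Rintegral do rewrite ReD.
rewrite RintegralD//.
under [X in _ +i* X]eq_Rintegral do rewrite ImD.
by rewrite RintegralD.
Qed.

Lemma cintZ c h : cintegrable h -> cint (fun t => c * h t) = c * cint h.
Proof.
move=> [h1 h2]; apply/eqP; rewrite eq_complex /cint ReM ImM /=.
under eq_Rintegral do rewrite ReM -mulNr.
rewrite RintegralD//; [|exact: integrable_finZ..].
rewrite !RintegralZl// mulNr eqxx /=.
under eq_Rintegral do rewrite ImM.
rewrite RintegralD//; [|exact: integrable_finZ..].
by rewrite !RintegralZl.
Qed.

(** The factor 2 comes from bounding the real and imaginary integrals separately. *)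
Lemma modc_cint_le h G : cintegrable h -> mu.-integrable I (EFin \o G) ->
  (forall t, I t -> modc (h t) <= G t) ->
  modc (cint h) <= 2 * (\int[mu]_(t in I) G t)%R.
Proof.
move=> [h1 h2] iG hG; apply: le_trans (modc_le _) _ => /=.
rewrite [leRHS]mulr_natl mulr2n lerD//.
  apply: le_trans (le_normr_Rintegral _ h1) _ => //.
  apply: le_Rintegral => //; first exact: integrable_norm.
  by move=> t It; rewrite (le_trans (modc_Re _))// hG.
apply: le_trans (le_normr_Rintegral _ h2) _ => //.
apply: le_Rintegral => //; first exact: integrable_norm.
by move=> t It; rewrite (le_trans (modc_Im _))// hG.
Qed.

End ComplexIntegral.

(** * Powers of the circle parameter, their integrals, and dominated convergence *)

Section CircleIntegrals.
Variable R : realType.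
Local Notation mu := (@lebesgue_measure R).
Local Notation I := (`[0, 2 * pi]%classic : set R).

Lemma modc_circle (l : circle R) : modc (val l) = 1.
Proof.
have /eqP := valP l; rewrite normE_modc => /eqP.
by rewrite eq_complex /= => /andP[/eqP].
Qed.

Lemma circle_neq0 (l : circle R) : val l != 0.
Proof. by rewrite -modc_eq0 modc_circle oner_neq0. Qed.

Lemma modc_exprz (x : R[i]) (k : int) : modc (x ^ k) = modc x ^ k.
Proof. by case: k => n; rewrite ?NegzE -?exprnN -?exprnP ?modcV modcX. Qed.

Lemma cis_exprz (t : R) (k : int) :
  val (cis t) ^ k = cos (k%:~R * t) +i* sin (k%:~R * t).
Proof.
have P n : val (cis t) ^+ n = cos (n%:R * t) +i* sin (n%:R * t).
  elim: n => [|n IH]; first by rewrite expr0 mul0r cos0 sin0.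
  rewrite exprS IH /= -natr1 mulrDl mul1r addrC cosD sinD; simpc.
  by congr (_ +i* _); rewrite addrC.
case: k => n; first by rewrite -exprnP P.
rewrite NegzE -exprnN P mulrNz mulNr cosN sinN -pmulrn.
(* On the circle the inverse is the conjugate, which settles negative exponents. *)
set a := _ * t; have u : (cos a +i* sin a) * (cos a -i* sin a) = 1.
  apply/eqP; rewrite eq_complex /=; apply/andP.
  by split; apply/eqP; rewrite -?(cos2Dsin2 a); ring.
exact: mulr1_eq u.
Qed.

Lemma continuous_cos_mul (c : R) : continuous (fun t : R => cos (c * t)).
Proof.
move=> t; apply: (@continuous_comp _ _ _ (fun t => c * t) cos).
  by apply: cvgMr; exact: cvg_id.
exact: continuous_cos.
Qed.

Lemma continuous_sin_mul (c : R) : continuous (fun t : R => sin (c * t)).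
Proof.
move=> t; apply: (@continuous_comp _ _ _ (fun t => c * t) sin).
  by apply: cvgMr; exact: cvg_id.
exact: continuous_sin.
Qed.

Lemma cmultiplier_cis (k : int) : cmultiplier (fun t : R => val (cis t) ^ k).
Proof.
split; last by exists 1 => t; rewrite modc_exprz modc_circle exp1rz.
have -> : (fun t : R => val (cis t) ^ k) =
    (fun t => cos (k%:~R * t) +i* sin (k%:~R * t)).
  by apply/funext => t; rewrite cis_exprz.
split => /=.
  by apply: measurable_funTS; apply: continuous_measurable_fun; exact: continuous_cos_mul.
by apply: measurable_funTS; apply: continuous_measurable_fun; exact: continuous_sin_mul.
Qed.

Lemma Rintegral_derive (f F : R -> R) : continuous f ->
  (forall t : R, is_derive t (1 : R) F (f t)) ->
  (\int[mu]_(t in I) f t)%R = F (2 * pi) - F 0.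
Proof.
move=> cf dF; have dvF (t : R) : derivable F t 1 by have := dF t.
have cF : continuous F.
  by move=> t; apply: differentiable_continuous; exact/derivable1_diffP.
rewrite /Rintegral (@continuous_FTC2 _ f F) //.
- by rewrite mulr_gt0// pi_gt0.
- by apply: continuous_subspaceT.
- split => //; first by apply: cvg_at_right_filter; exact: cF.
  by apply: cvg_at_left_filter; exact: cF.
- by move=> t _; rewrite derive1E; exact: derive_val.
Qed.

(** For nonzero k the antiderivatives sin(kt)/k and -cos(kt)/k take equal values at 0 and 2 pi, by
    periodicity; for k = 0 the integrand is 1. *)
Lemma cint_cis (k : int) :
  cint (fun t : R => val (cis t) ^ k) = if k == 0 then (2 * pi)%:C else 0.
Proof.
rewrite /cint; under eq_Rintegral do rewrite cis_exprz /=.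
under [X in _ +i* X]eq_Rintegral do rewrite cis_exprz /=.
have [->|k0] := eqVneq k 0.
  have I1 : (\int[mu]_(t in I) 1)%R = 2 * pi :> R.
    by rewrite -[RHS]subr0; apply: (@Rintegral_derive (fun=> 1) id) => t; exact: cvg_cst.
  under eq_Rintegral do rewrite mulr0z mul0r cos0.
  rewrite I1; under eq_Rintegral do rewrite mulr0z mul0r sin0.
  by rewrite Rintegral_cst// mul0r.
have k0' : k%:~R != 0 :> R by rewrite intr_eq0.
have per (f : R -> R) : (forall t : R, f (t + 2 * pi) = f t) ->
    f (k%:~R * (2 * pi)) = f 0.
  move=> fp; have fn n (t : R) : f (t + n%:R * (2 * pi)) = f t.
    by elim: n => [|n IH]; rewrite ?mul0r ?addr0// -natr1 mulrDl mul1r addrA fp.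
  case: k {k0 k0'} => n; first by rewrite -pmulrn -[_ * _]add0r fn.
  by rewrite NegzE mulrNz -pmulrn mulNr -(fn n.+1) addNr.
have dlin (t : R) : is_derive t (1 : R) (fun t : R => k%:~R * t) k%:~R.
  have := @is_deriveZ R R R id k%:~R t 1 1 (is_derive_id _ _).
  by rewrite /GRing.scale /= mulr1.
have dsin (t : R) :
    is_derive t (1 : R) (fun t => k%:~R^-1 * sin (k%:~R * t)) (cos (k%:~R * t)).
  have := is_deriveZ k%:~R^-1 (is_derive1_comp (is_derive_sin _) (dlin t)).
  by rewrite /GRing.scale /= mulrCA mulVf// mulr1.
have dcos (t : R) :
    is_derive t (1 : R) (fun t => - k%:~R^-1 * cos (k%:~R * t)) (sin (k%:~R * t)).
  have := is_deriveZ (- k%:~R^-1) (is_derive1_comp (is_derive_cos _) (dlin t)).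
  rewrite /GRing.scale /=.
  suff -> : - k%:~R^-1 * (- sin (k%:~R * t) * k%:~R) = sin (k%:~R * t) by [].
  by move: (sin _) => s; field.
rewrite (Rintegral_derive (@continuous_cos_mul _) dsin).
rewrite (Rintegral_derive (@continuous_sin_mul _) dcos).
rewrite !per ?mulr0 ?subrr// => t;
  by rewrite mulr_natl mulr2n addrA ?cosDpi ?sinDpi ?opprK.
Qed.

(** Dominated convergence on real and imaginary parts. Measurability of the limit is returned as
    well: it later yields the measurability of a matrix exponential along a loop. *)
Lemma cint_dominated (h_ : nat -> R -> R[i]) (h : R -> R[i]) (m : R -> R) :
  (forall n, cmeasurable (h_ n)) ->
  (forall t, I t -> modc (h_ n t - h t) @[n --> \oo] --> (0 : R)) ->
  mu.-integrable I (EFin \o m) ->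
  (forall n t, I t -> modc (h_ n t) <= m t) ->
  cmeasurable h /\ modc (cint (h_ n) - cint h) @[n --> \oo] --> (0 : R).
Proof.
move=> mh hh im hm.
have cvg_part (p : R[i] -> R) : (forall x, `|p x| <= modc x) ->
    (forall x y, p (x - y) = p x - p y) ->
    forall t, I t -> p (h_ n t) @[n --> \oo] --> p (h t).
  move=> pm pB t It; apply/cvgrPdistC_lt => e e0.
  have /cvgrPdist_lt/(_ e e0) := hh t It; apply: filterS => n.
  rewrite sub0r normrN ger0_norm ?modc_ge0// => le_e.
  by rewrite -pB (le_lt_trans (pm _) le_e).
have ReB (x y : R[i]) : complex.Re (x - y) = complex.Re x - complex.Re y.
  by case: x y => [? ?] [].
have ImB (x y : R[i]) : complex.Im (x - y) = complex.Im x - complex.Im y.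
  by case: x y => [? ?] [].
have hRe := cvg_part _ (@modc_Re R) ReB.
have hIm := cvg_part _ (@modc_Im R) ImB.
have mRe : measurable_fun I (fun t => complex.Re (h t)).
  by apply: measurable_fun_cvg hRe => n; case: (mh n).
have mIm : measurable_fun I (fun t => complex.Im (h t)).
  by apply: measurable_fun_cvg hIm => n; case: (mh n).
split; first by [].
have cvg_int (f_ : nat -> R -> R) (f : R -> R) :
    (forall n, measurable_fun I (f_ n)) -> measurable_fun I f ->
    (forall n t, I t -> `|f_ n t| <= m t) ->
    (forall t, I t -> f_ n t @[n --> \oo] --> f t) ->
    (\int[mu]_(t in I) f_ n t)%R @[n --> \oo] --> (\int[mu]_(t in I) f t)%R.
  move=> mf_ mf f_m ff.
  have mt t : I t -> `|f t| <= m t.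
    move=> It; apply: (cvgr_to_le (cvg_norm (ff t It))).
    by near=> n; exact: f_m.
  have if_ n : mu.-integrable I (EFin \o f_ n).
    exact: le_integrable_fin (mf_ n) (f_m n) im.
  have iff : mu.-integrable I (EFin \o f).
    exact: le_integrable_fin mf mt im.
  apply/fine_cvg; rewrite fineK; last exact: integrable_fin_num.
  apply: (@dominated_cvg _ _ _ mu I _ (fun n => EFin \o f_ n) _ (EFin \o m)) => //.
  - by move=> n; have /measurable_EFinP := mf_ n.
  - by move=> t It; apply: cvg_EFin; [exact: nearW | exact: ff].
have iRe := cvg_int _ _ (fun n => proj1 (mh n)) mRe
  (fun n t It => le_trans (modc_Re _) (hm n t It)) hRe.
have iIm := cvg_int _ _ (fun n => proj2 (mh n)) mIm
  (fun n t It => le_trans (modc_Im _) (hm n t It)) hIm.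
pose a n := `|(\int[mu]_(t in I) complex.Re (h_ n t))%R - (\int[mu]_(t in I) complex.Re (h t))%R|
  + `|(\int[mu]_(t in I) complex.Im (h_ n t))%R - (\int[mu]_(t in I) complex.Im (h t))%R|.
apply: (@squeeze_cvgr _ _ _ _ (cst 0) a); last 2 first.
- exact: cvg_cst.
- rewrite /a -[X in _ --> X](addr0 0); apply: cvgD; apply/norm_cvg0P.
    exact/subr_cvg0.
  exact/subr_cvg0.
by near=> n; apply/andP; split; [exact: modc_ge0 | exact: modc_le].
Unshelve. all: by end_near.
Qed.

End CircleIntegrals.

(** * Scalar Fourier coefficients and the scalar Hardy space *)

Section ScalarFourier.
Variable R : realType.
Local Notation mu := (@lebesgue_measure R).
Local Notation I := (`[0, 2 * pi]%classic : set R).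
Implicit Types (g h : R -> R[i]).

Definition sfourier g (k : int) : R[i] :=
  ((2 * pi)^-1)%:C * cint (fun t => g t * val (cis t) ^ (- k)).

Definition shardy g := csquare g /\ forall k : int, k < 0 -> sfourier g k = 0.

Lemma csquare_cis g (k : int) : csquare g ->
  csquare (fun t => val (cis t) ^ k * g t).
Proof. by move=> g2; apply: (csquareM (cmultiplier_cis _ k) g2). Qed.

Lemma cintegrable_cis g (k : int) : csquare g ->
  cintegrable (fun t => g t * val (cis t) ^ k).
Proof.
move=> g2; have := csquare_integrable (csquare_cis k g2).
by congr cintegrable; apply/funext => t; rewrite mulrC.
Qed.

Lemma sfourierD g h k : csquare g -> csquare h ->
  sfourier (fun t => g t + h t) k = sfourier g k + sfourier h k.
Proof.
move=> g2 h2; rewrite /sfourier -mulrDr -cintD; try exact: cintegrable_cis.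
by congr (_ * cint _); apply/funext => t; rewrite mulrDl.
Qed.

Lemma sfourierZ c g k : csquare g ->
  sfourier (fun t => c * g t) k = c * sfourier g k.
Proof.
move=> g2; rewrite /sfourier [RHS]mulrCA -[in RHS]cintZ; last exact: cintegrable_cis.
by congr (_ * cint _); apply/funext => t; rewrite mulrA.
Qed.

Lemma csquareZ c g : csquare g -> csquare (fun t => c * g t).
Proof. exact/csquareM/cmultiplier_cst. Qed.

Lemma sfourier0 k : sfourier (fun=> 0) k = 0.
Proof.
have := sfourierZ 0 k (@csquare_cst R 0); by rewrite !mul0r.
Qed.

Lemma sfourier_sum (J : Type) (r : seq J) (F : J -> R -> R[i]) k :
  (forall j, csquare (F j)) ->
  sfourier (fun t => \sum_(j <- r) F j t) k = \sum_(j <- r) sfourier (F j) k.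
Proof.
move=> F2; elim: r => [|j r IH].
  have -> : (fun t => \sum_(j <- [::]) F j t) = fun=> 0.
    by apply/funext => t; rewrite big_nil.
  by rewrite big_nil sfourier0.
have -> : (fun t => \sum_(i <- j :: r) F i t) =
    (fun t => F j t + \sum_(i <- r) F i t).
  by apply/funext => t; rewrite big_cons.
by rewrite sfourierD ?big_cons ?IH//; exact: csquare_sum.
Qed.

Lemma sfourier_shift (m k : int) g :
  sfourier (fun t => val (cis t) ^ m * g t) k = sfourier g (k - m).
Proof.
congr (_ * cint _); apply/funext => t.
by rewrite mulrAC -exprzDr ?unitfE ?circle_neq0// mulrC opprB.
Qed.

Lemma sfourier_cst c k : sfourier (fun=> c) k = if k == 0 then c else 0.
Proof.
have c1 : cintegrable (fun t : R => val (cis t) ^ (- k)).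
  by apply/csquare_integrable/csquare_multiplier/cmultiplier_cis.
rewrite /sfourier cintZ// cint_cis oppr_eq0; case: eqP => _; last by rewrite !mulr0.
by rewrite mulrCA -rmorphM mulVf ?rmorph1 ?mulr1// mulf_neq0// gt_eqF// pi_gt0.
Qed.

Lemma sfourier_cis c m k :
  sfourier (fun t => c * val (cis t) ^ m) k = if k == m then c else 0.
Proof.
under [X in sfourier X]eq_fun do rewrite mulrC.
by rewrite sfourier_shift sfourier_cst subr_eq0.
Qed.

Lemma sfourier_dominated (h_ : nat -> R -> R[i]) h (m : R -> R) k :
  (forall n, cmeasurable (h_ n)) ->
  (forall t, I t -> modc (h_ n t - h t) @[n --> \oo] --> (0 : R)) ->
  mu.-integrable I (EFin \o m) ->
  (forall n t, I t -> modc (h_ n t) <= m t) ->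
  modc (sfourier (h_ n) k - sfourier h k) @[n --> \oo] --> (0 : R).
Proof.
move=> mh hh im hm.
have [] := @cint_dominated R (fun n t => h_ n t * val (cis t) ^ (- k))
  (fun t => h t * val (cis t) ^ (- k)) m.
- by move=> n; apply: cmeasurableM => //; have [] := cmultiplier_cis R (- k).
- move=> t It; under eq_fun do
    rewrite -mulrBl modcM modc_exprz modc_circle exp1rz mulr1.
  exact: hh.
- exact: im.
- by move=> n t It; rewrite modcM modc_exprz modc_circle exp1rz mulr1 hm.
move=> _ cv.
have -> : (fun n => modc (sfourier (h_ n) k - sfourier h k)) = (fun n =>
    modc ((2 * pi)^-1)%:C * modc (cint (fun t => h_ n t * val (cis t) ^ (- k)) -
                                  cint (fun t => h t * val (cis t) ^ (- k)))).
  by apply/funext => n; rewrite -mulrBr modcM.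
by rewrite -(mulr0 (modc ((2 * pi)^-1)%:C)); apply: cvgMr.
Qed.

Lemma shardy_cst c : shardy (fun=> c).
Proof.
split; first exact: csquare_cst.
by move=> k k0; rewrite sfourier_cst lt_eqF.
Qed.

Lemma shardyZ c g : shardy g -> shardy (fun t => c * g t).
Proof.
move=> [g2 gk]; split; first exact: csquareZ.
by move=> k k0; rewrite sfourierZ// gk// mulr0.
Qed.

Lemma shardy_sum (J : Type) (r : seq J) (F : J -> R -> R[i]) :
  (forall j, shardy (F j)) -> shardy (fun t => \sum_(j <- r) F j t).
Proof.
move=> hF; split; first by apply: csquare_sum => j; case: (hF j).
move=> k k0; rewrite sfourier_sum; last by move=> j; case: (hF j).
by rewrite big1// => j _; case: (hF j) => _ ->.
Qed.

Lemma shardy_shift (m : int) g : 0 <= m -> shardy g ->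
  shardy (fun t => val (cis t) ^ m * g t).
Proof.
move=> m0 [g2 gk]; split; first exact: csquare_cis.
by move=> k k0; rewrite sfourier_shift gk// subr_lt0 (lt_le_trans k0).
Qed.

(** The form in which closedness of H_+ is used: under domination each negative Fourier coefficient
    passes to the limit and stays 0. *)
Lemma shardy_dominated (h_ : nat -> R -> R[i]) h (m : R -> R) :
  (forall n, shardy (h_ n)) -> csquare h ->
  (forall t, I t -> modc (h_ n t - h t) @[n --> \oo] --> (0 : R)) ->
  mu.-integrable I (EFin \o m) ->
  (forall n t, I t -> modc (h_ n t) <= m t) -> shardy h.
Proof.
move=> sh h2 hh im hm; split=> // k k0.
have mh n : cmeasurable (h_ n) by apply: csquare_measurable; case: (sh n).
have := sfourier_dominated k mh hh im hm.
under eq_fun => n do rewrite (proj2 (sh n) k k0) sub0r modcN.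
move=> cv; apply/eqP; rewrite -modc_eq0 eq_le modc_ge0 andbT.
by apply: (cvgr_to_ge cv); near=> n.
Unshelve. all: by end_near.
Qed.

(** The constant depends on neither [g] nor [k], so the growth of the Fourier coefficients of the
    powers of a loop is governed by sup bounds on these powers. *)
Lemma modc_sfourier_le g k (B : R) : csquare g -> (forall t, modc (g t) <= B) ->
  modc (sfourier g k) <= modc ((2 * pi)^-1)%:C * (2 * fine (mu I)) * B.
Proof.
move=> g2 gB; rewrite modcM -mulrA ler_wpM2l ?modc_ge0//.
have := @modc_cint_le R (fun t => g t * val (cis t) ^ (- k)) (fun=> B).
rewrite Rintegral_cst// => H; rewrite -mulrA [fine _ * _]mulrC; apply: H.
- exact: cintegrable_cis.
- exact: integrable_cst_period.
- by move=> t _; rewrite modcM modc_exprz modc_circle exp1rz mulr1.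
Qed.

End ScalarFourier.

(** * Matrix exponentials *)

Section MatrixExponential.
Variables (R : realType) (n : nat).
Implicit Types (A : 'M[R[i]]_n) (B : R).

(** An entrywise bound in place of an operator norm: every matrix product then costs a factor [n],
    the origin of [n%:R * B] below. *)
Definition mbound A B := forall i j, modc (A i j) <= B.

Definition expmx_part A (N : nat) : 'M[R[i]]_n :=
  \sum_(k < N) (k`!%:R^-1 : R[i]) *: A ^+ k.

Lemma mbound_ge0 A B : mbound A B -> 'I_n -> 0 <= B.
Proof. by move=> AB i; rewrite (le_trans _ (AB i i))// modc_ge0. Qed.

Lemma mboundX A B k : mbound A B -> mbound (A ^+ k) ((n%:R * B) ^+ k).
Proof.
move=> AB; elim: k => [|k IH] i j.
  by rewrite !expr0 mxE; case: eqP; rewrite ?modc1 ?modc0.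
have B0 := mbound_ge0 AB i.
rewrite exprS mxE (le_trans (ler_modc_sum _ _ _))//.
apply: (@le_trans _ _ (\sum_(l < n) B * (n%:R * B) ^+ k)).
  by apply: ler_sum => l _; rewrite modcM ler_pM ?modc_ge0.
by rewrite sumr_const card_ord [in leRHS]exprS -mulrA [leRHS]mulr_natl.
Qed.

Lemma modc_exp_coeff A B k i j : mbound A B ->
  modc (((k`!%:R^-1 : R[i]) *: A ^+ k) i j) <= exp_coeff (n%:R * B) k.
Proof.
move=> AB; rewrite mxE modcM modcV modc_nat mulrC /exp_coeff /=.
by rewrite ler_wpM2r ?invr_ge0// mboundX.
Qed.

Lemma expmx_part_entry A N i j :
  expmx_part A N i j = \sum_(k < N) ((k`!%:R^-1 : R[i]) *: A ^+ k) i j.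
Proof. by rewrite /expmx_part summxE. Qed.

Lemma mbound_expmx_part A B N : mbound A B ->
  mbound (expmx_part A N) (expR (n%:R * B)).
Proof.
move=> AB i j; have B0 := mbound_ge0 AB i.
rewrite expmx_part_entry (le_trans (ler_modc_sum _ _ _))//.
apply: le_trans (@expR_partial_le R (n%:R * B) N _); last by rewrite mulr_ge0.
by apply: ler_sum => k _; exact: modc_exp_coeff.
Qed.

(** [expmx] is made of [limn] of real and imaginary series, which carry meaning only once both are
    shown to converge; comparison with the scalar series of exp(n B) does this. *)
Lemma expmx_cvg A B i j : mbound A B ->
  modc (expmx_part A N i j - expmx A i j) @[N --> \oo] --> (0 : R).
Proof.
move=> AB.
pose T k := ((k`!%:R^-1 : R[i]) *: A ^+ k) i j.
have cv (p : R[i] -> R) : (forall x, `|p x| <= modc x) ->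
    series (fun k => p (T k)) @ \oo --> limn (series (fun k => p (T k)) : nat -> R).
  move=> pm; apply: (@normed_cvg R R); apply: series_le_cvg.
  - by move=> k; exact: normr_ge0.
  - by move=> k; exact: le_trans (modc_ge0 _) (modc_exp_coeff k i j AB).
  - by move=> k; exact: le_trans (pm _) (modc_exp_coeff k i j AB).
  - exact: is_cvg_series_exp_coeff.
have cRe := cv _ (@modc_Re R); have cIm := cv _ (@modc_Im R).
pose a N := `|series (fun k => complex.Re (T k)) N - limn (series (fun k => complex.Re (T k)) : nat -> R)|
  + `|series (fun k => complex.Im (T k)) N - limn (series (fun k => complex.Im (T k)) : nat -> R)|.
apply: (@squeeze_cvgr _ _ _ _ (cst 0) a); last 2 first.
- exact: cvg_cst.
- rewrite /a -[X in _ --> X](addr0 0); apply: cvgD; apply/norm_cvg0P;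
    exact/subr_cvg0.
near=> N; apply/andP; split; first exact: modc_ge0.
have E : expmx_part A N i j =
    series (fun k => complex.Re (T k)) N +i* series (fun k => complex.Im (T k)) N.
  rewrite expmx_part_entry /series /= !big_mkord.
  elim/big_rec3: _ => //= k x y z _ ->.
  by rewrite -/(T k); case: (T k).
rewrite E mxE; apply: le_trans (modc_le _) _; exact: lexx.
Unshelve. all: by end_near.
Qed.

Lemma mbound_expmx A B : mbound A B -> mbound (expmx A) (expR (n%:R * B)).
Proof.
move=> AB i j.
have lim : modc (expmx_part A N i j - expmx A i j) + expR (n%:R * B)
    @[N --> \oo] --> 0 + expR (n%:R * B).
  by apply: cvgD; [exact: expmx_cvg AB | exact: cvg_cst].
rewrite add0r in lim; apply: (cvgr_to_ge lim).
near=> N; rewrite -[in leLHS](subrK (expmx_part A N i j) (expmx A i j)).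
apply: le_trans (ler_modcD _ _) _; rewrite [leLHS]addrC modc_distC addrC lerD2l.
exact: mbound_expmx_part.
Unshelve. all: by end_near.
Qed.

End MatrixExponential.

(** * Inverse of a matrix exponential, through truncated exponential polynomials *)

Section ExponentialInverse.
Variable R : realType.
Implicit Types (B : R).

Lemma horner_mx_poly n (A : 'M[R[i]]_n.+1) K (c : nat -> R[i]) :
  horner_mx A (\poly_(k < K) c k) = \sum_(k < K) c k *: A ^+ k.
Proof.
rewrite poly_def rmorph_sum; apply: eq_bigr => k _.
by rewrite /= horner_mxZ rmorphXn /= horner_mx_X.
Qed.

Definition expp N : {poly R[i]} := \poly_(k < N) (k`!%:R^-1 : R[i]).
Definition exppN N : {poly R[i]} := \poly_(k < N) ((-1) ^+ k * k`!%:R^-1 : R[i]).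

Lemma fact_binom (F : numFieldType) m j : (j <= m)%N ->
  (j`!%:R^-1 * (m - j)`!%:R^-1 : F) = m`!%:R^-1 *+ 'C(m, j).
Proof.
move=> jm; have f0 k : k`!%:R != 0 :> F by rewrite pnatr_eq0 -lt0n fact_gt0.
have H : 'C(m, j)%:R * (j`!%:R * (m - j)`!%:R) = m`!%:R :> F.
  by rewrite -!natrM bin_fact.
have b0 : 'C(m, j)%:R != 0 :> F by rewrite pnatr_eq0 -lt0n bin_gt0.
by rewrite -mulr_natl -H; field; rewrite b0 !f0.
Qed.

(** Below degree N the truncation is invisible, and the coefficient is the binomial expansion of (1
    - 1)^m divided by m!. *)
Lemma coef_expp_mul N m : (m < N)%N -> (expp N * exppN N)`_m = (m == 0%N)%:R.
Proof.
move=> mN; rewrite coefM.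
transitivity ((1 - 1) ^+ m * m`!%:R^-1 : R[i]); last first.
  by rewrite subrr expr0n; case: m mN => [|m] _ /=; rewrite ?fact0 ?invr1 ?mulr1 ?mul0r.
rewrite addrC exprDn mulr_suml; apply: eq_bigr => -[j /=]; rewrite ltnS => jm _.
rewrite !coef_poly (leq_ltn_trans jm mN) (leq_ltn_trans (leq_subr _ _) mN).
rewrite expr1n mulr1 mulrCA fact_binom//.
by rewrite !mulrnAr mulrnAl.
Qed.

(** With absolute values the same expansion becomes (1 + 1)^m / m!; terms lost to truncation only
    lower the sum. *)
Lemma modc_coef_expp_mul N m : modc (expp N * exppN N)`_m <= 2 ^+ m / m`!%:R.
Proof.
rewrite coefM (le_trans (ler_modc_sum _ _ _))//.
rewrite (_ : 2 = 1 + 1)// exprDn mulr_suml; apply: ler_sum => -[j /=].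
rewrite ltnS => jm _; rewrite !expr1n mulr1 mulrnAl mul1r -fact_binom// modcM.
rewrite !coef_poly ler_pM ?modc_ge0//.
  by case: ifP => _; rewrite ?modc0 ?invr_ge0// modcV modc_nat.
case: ifP => _; rewrite ?modc0 ?invr_ge0//.
by rewrite modcM modcV modc_nat modcX modcN modc1 expr1n mul1r.
Qed.

(** The product of the truncated polynomials minus 1 lives in degrees N to 2N - 1, with coefficients
    at most 2^m / m!. Evaluated at [A] it is dominated by that block of the series of exp(2 n B). *)
Lemma expmx_part_mulN n (A : 'M[R[i]]_n) B N i j : mbound A B -> (0 < N)%N ->
  modc ((expmx_part A N *m expmx_part (- A) N) i j - (1%:M : 'M[R[i]]_n) i j) <=
  series (exp_coeff (2 * (n%:R * B))) (N + N)%N -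
  series (exp_coeff (2 * (n%:R * B))) N.
Proof.
case: n A i j => [A []//|n] A i j AB N0.
set D := _ * B.
have -> : expmx_part A N = horner_mx A (expp N) by rewrite horner_mx_poly.
have -> : expmx_part (- A) N = horner_mx A (exppN N).
  rewrite horner_mx_poly; apply: eq_bigr => k _.
  by rewrite -scaleN1r exprZn scalerA mulrC.
pose r := expp N * exppN N - 1.
have rm m : (m < N)%N -> r`_m = 0.
  by move=> mN; rewrite coefB coef_expp_mul// coef1 subrr.
have rle m : modc r`_m <= 2 ^+ m / m`!%:R.
  have [mN|Nm] := ltnP m N.
    by rewrite rm// modc0 divr_ge0// exprn_ge0.
  by rewrite coefB coef1 gtn_eqF ?subr0 ?modc_coef_expp_mul// (leq_trans N0).
have size_r : (size r <= N + N)%N.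
  rewrite (leq_trans (size_polyD _ _))// geq_max size_polyN size_poly1 addn_gt0 N0 andbT.
  rewrite (leq_trans (size_polyMleq _ _))// (leq_trans (leq_pred _))//.
  by rewrite leq_add// size_poly.
have rE : r = \poly_(k < N + N) r`_k.
  apply/polyP => k; rewrite coef_poly; case: ltnP => // kN.
  by rewrite nth_default// (leq_trans size_r).
have -> : horner_mx A (expp N) *m horner_mx A (exppN N) = horner_mx A r + 1%:M.
  by rewrite /r rmorphB rmorph1 subrK rmorphM.
rewrite mxE addrK rE horner_mx_poly summxE.
apply: le_trans (ler_modc_sum _ _ _) _.
have B0 := mbound_ge0 AB i.
rewrite sub_series_geq ?leq_addr//.
rewrite -(big_mkord xpredT (fun k => modc ((r`_k *: A ^+ k) i j))).
rewrite (@big_cat_nat _ _ _ N) ?leq_addr//= big_nat_cond big1 ?add0r.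
  apply: ler_sum => k _; rewrite mxE modcM /exp_coeff /= exprMn mulrAC.
  by rewrite ler_pM ?modc_ge0//; exact: mboundX.
by move=> k /andP[/andP[_ kN] _]; rewrite rm// scale0r mxE modc0.
Qed.

Lemma cvg_sum0 (J : Type) (r : seq J) (f : J -> nat -> R) :
  (forall k, f k N @[N --> \oo] --> (0 : R)) ->
  \sum_(k <- r) f k N @[N --> \oo] --> (0 : R).
Proof.
move=> f0; elim: r => [|k r IH].
  rewrite (_ : (fun N => _) = cst 0); first exact: cvg_cst.
  by apply/funext => N; rewrite big_nil.
rewrite (_ : (fun N => _) = (fun N => f k N + \sum_(k <- r) f k N)).
  by rewrite -[X in _ --> X](addr0 0); apply: cvgD.
by apply/funext => N; rewrite big_cons.
Qed.

Lemma mulmx_expmxN n (A : 'M[R[i]]_n) B : mbound A B -> expmx A *m expmx (- A) = 1%:M.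
Proof.
move=> AB; have NAB : mbound (- A) B by move=> i j; rewrite mxE modcN.
apply/matrixP => i j; apply/eqP; rewrite -subr_eq0 -modc_eq0 eq_le modc_ge0 andbT.
set E := expR (n%:R * B); set D := 2 * (n%:R * B).
have B0 := mbound_ge0 AB i; have D0 : 0 <= D by rewrite !mulr_ge0.
have cS := is_cvg_series_exp_coeff D.
pose u N := \sum_(k < n) (E * modc (expmx_part A N i k - expmx A i k) +
  E * modc (expmx_part (- A) N k j - expmx (- A) k j)) +
  (limn (series (exp_coeff D)) - series (exp_coeff D) N).
have lim_u : u N @[N --> \oo] --> (0 : R).
  rewrite -(addr0 0); apply: cvgD; last first.
    rewrite -(subrr (limn (series (exp_coeff D)))); apply: cvgB => //.
    exact: cvg_cst.
  apply: cvg_sum0 => k; rewrite -(addr0 0).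
  by apply: cvgD; rewrite -(mulr0 E); apply: cvgMr; apply: expmx_cvg; eassumption.
apply: (cvgr_to_ge lim_u).
exists 1%N => //= N N0; rewrite /u.
(* The exponentials are exchanged for their partial sums one at a time. The last bracket is the
   polynomial error, at most a tail of the series of exp(D). *)
have part : (expmx A *m expmx (- A)) i j - (1%:M : 'M[R[i]]_n) i j =
   \sum_(k < n) (expmx A i k * (expmx (- A) k j - expmx_part (- A) N k j) +
     (expmx A i k - expmx_part A N i k) * expmx_part (- A) N k j) +
   ((expmx_part A N *m expmx_part (- A) N) i j - (1%:M : 'M[R[i]]_n) i j).
  rewrite addrA; congr (_ - _); rewrite !mxE -big_split /=; apply: eq_bigr => k _.
  ring.
rewrite part; apply: le_trans (ler_modcD _ _) _; apply: lerD.
  apply: le_trans (ler_modc_sum _ _ _) _; apply: ler_sum => k _.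
  apply: le_trans (ler_modcD _ _) _; rewrite !modcM addrC; apply: lerD.
    by rewrite mulrC modc_distC ler_pM ?modc_ge0//; exact: mbound_expmx_part.
  by rewrite (modc_distC (expmx _ _ _)) ler_pM ?modc_ge0//; exact: mbound_expmx.
apply: le_trans (expmx_part_mulN i j AB N0) _; rewrite lerD2r.
apply: (nondecreasing_cvgn_le _ cS); apply: nondecreasing_series => k _ _.
by rewrite /exp_coeff /= divr_ge0 ?exprn_ge0.
Qed.

End ExponentialInverse.

(** * Loops acting on the Hardy space *)

Section LoopsOnHardySpace.
Variables (R : realType) (n : nat).
Local Notation mu := (@lebesgue_measure R).
Local Notation I := (`[0, 2 * pi]%classic : set R).
Implicit Types (f : circle R -> 'cV[R[i]]_n) (M xi : circle R -> 'M[R[i]]_n).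

Lemma HplusE f : Hplus f <-> forall j, shardy (fun t => f (cis t) j 0).
Proof.
split=> [[f2 fk] j|fH].
  split; first exact: f2.
  by move=> k k0; have /matrixP/(_ j 0) := fk k k0; rewrite !mxE.
split; first by move=> j; have [] := fH j.
move=> k k0; apply/matrixP => j j'; rewrite !mxE.
by have [_ /(_ k k0)] := fH j.
Qed.

Definition mult_loop M := forall i j, cmultiplier (fun t => M (cis t) i j).

Lemma csquare_loop M f : mult_loop M -> (forall j, csquare (fun t => f (cis t) j 0)) ->
  forall j, csquare (fun t => (M (cis t) *m f (cis t)) j 0).
Proof.
move=> mM f2 j; have -> : (fun t => (M (cis t) *m f (cis t)) j 0) =
    (fun t => \sum_(k < n) M (cis t) j k * f (cis t) k 0).
  by apply/funext => t; rewrite mxE.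
by apply: csquare_sum => k; exact: csquareM.
Qed.

Lemma mult_loopM M M' : mult_loop M -> mult_loop M' ->
  mult_loop (fun l => M l *m M' l).
Proof.
move=> mM mM' i j; have -> : (fun t => (M (cis t) *m M' (cis t)) i j) =
    (fun t => \sum_(k < n) M (cis t) i k * M' (cis t) k j).
  by apply/funext => t; rewrite mxE.
by apply: cmultiplier_sum => k; exact: cmultiplierM.
Qed.

Lemma mult_loopX M k : mult_loop M -> mult_loop (fun l => M l ^+ k).
Proof.
move=> mM; elim: k => [|k IH].
  by move=> i j; exact: (cmultiplier_cst ((1 : 'M[R[i]]_n) i j)).
rewrite (_ : (fun l => M l ^+ k.+1) = fun l => M l *m M l ^+ k).
  exact: mult_loopM.
by apply/funext => l; rewrite exprS.
Qed.

Lemma mult_loopZ c M : mult_loop M -> mult_loop (fun l => c *: M l).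
Proof.
move=> mM i j; have -> : (fun t => (c *: M (cis t)) i j) = (fun t => c * M (cis t) i j).
  by apply/funext => t; rewrite mxE.
by apply: cmultiplierM => //; exact: cmultiplier_cst.
Qed.

Lemma mult_loop_expmx_part M N : mult_loop M -> mult_loop (fun l => expmx_part (M l) N).
Proof.
move=> mM i j; have -> : (fun t => expmx_part (M (cis t)) N i j) =
    (fun t => \sum_(k < N) ((k`!%:R^-1 : R[i]) *: M (cis t) ^+ k) i j).
  by apply/funext => t; rewrite expmx_part_entry.
by apply: cmultiplier_sum => k; exact: (mult_loopZ _ (mult_loopX k mM)).
Qed.

Lemma mult_loop_expmx M B : mult_loop M -> (forall t, mbound (M (cis t)) B) ->
  mult_loop (fun l => expmx (M l)).
Proof.
move=> mM MB i j; split; last first.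
  by exists (expR (n%:R * B)) => t; exact: mbound_expmx.
have mp N := proj1 (mult_loop_expmx_part N mM i j).
have [] := @cint_dominated R (fun N t => expmx_part (M (cis t)) N i j)
  (fun t => expmx (M (cis t)) i j) (fun=> expR (n%:R * B)) mp => //.
- by move=> t _; exact: expmx_cvg (MB t).
- exact: integrable_cst_period.
- by move=> N t _; exact: mbound_expmx_part.
Qed.

Lemma integrable_fin_sum (J : Type) (r : seq J) (F : J -> R -> R) :
  (forall j, mu.-integrable I (EFin \o F j)) ->
  mu.-integrable I (EFin \o (fun t => \sum_(j <- r) F j t)).
Proof.
move=> iF; elim: r => [|j r IH].
  have -> : (fun t => \sum_(j <- [::]) F j t) = cst 0.
    by apply/funext => t; rewrite big_nil.
  exact: integrable_cst_period.
have -> : (fun t => \sum_(i <- j :: r) F i t) =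
    (fun t => F j t + \sum_(i <- r) F i t).
  by apply/funext => t; rewrite big_cons.
exact: integrable_finD.
Qed.

(** The majorant may not depend on N: partial sums of the exponential are bounded entrywise by exp(n
    B), and |f_k| <= 1 + |f_k|^2 is integrable. *)
Lemma expmx_loop_dominated M B f i : mult_loop M -> (forall t, mbound (M (cis t)) B) ->
  (forall j, csquare (fun t => f (cis t) j 0)) ->
  exists m : R -> R, [/\ mu.-integrable I (EFin \o m),
    forall t, modc ((expmx_part (M (cis t)) N *m f (cis t)) i 0 -
       (expmx (M (cis t)) *m f (cis t)) i 0) @[N --> \oo] --> (0 : R) &
    forall N t, modc ((expmx_part (M (cis t)) N *m f (cis t)) i 0) <= m t].
Proof.
move=> mM MB f2; set E := expR (n%:R * B).
exists (fun t => \sum_(k < n) E * (1 + modc (f (cis t) k 0) ^+ 2)); split.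
- apply: integrable_fin_sum => k; apply: integrable_finZ.
  apply: integrable_finD (integrable_modc_sqr (f2 k)).
  exact: integrable_cst_period.
- move=> t; pose u N := \sum_(k < n) modc (f (cis t) k 0) *
    modc (expmx_part (M (cis t)) N i k - expmx (M (cis t)) i k).
  apply: (@squeeze_cvgr _ _ _ _ (cst 0) u); last 2 first.
  + exact: cvg_cst.
  + apply: cvg_sum0 => k; rewrite -(mulr0 (modc (f (cis t) k 0))).
    by apply: cvgMr; exact: expmx_cvg (MB t).
  near=> N; apply/andP; split; first exact: modc_ge0.
  rewrite !mxE -sumrB (le_trans (ler_modc_sum _ _ _))//.
  by apply: ler_sum => k _; rewrite -mulrBl modcM mulrC.
- move=> N t; rewrite mxE (le_trans (ler_modc_sum _ _ _))//.
  apply: ler_sum => k _; rewrite modcM ler_pM ?modc_ge0//.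
    exact: mbound_expmx_part.
  have := sqr_ge0 (modc (f (cis t) k 0) - 1); have := modc_ge0 (f (cis t) k 0); nra.
Unshelve. all: by end_near.
Qed.

(** Partial sums of the exponential are polynomials in [M], hence preserve H_+, and H_+ is closed
    under dominated limits. *)
Lemma Hplus_expmx M B f : mult_loop M -> (forall t, mbound (M (cis t)) B) ->
  (forall g, Hplus g -> Hplus (fun l => M l *m g l)) ->
  Hplus f -> Hplus (fun l => expmx (M l) *m f l).
Proof.
move=> mM MB MH fH.
have f2 j : csquare (fun t => f (cis t) j 0) by case: fH => /(_ j).
have MX k : Hplus (fun l => M l ^+ k *m f l).
  elim: k => [|k IH].
    rewrite (_ : (fun l => _) = f)//.
    by apply/funext => l; rewrite expr0 mul1mx.
  rewrite (_ : (fun l => _) = fun l => M l *m (M l ^+ k *m f l)); first exact: MH.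
  by apply/funext => l; rewrite exprS mulmxA.
apply/HplusE => i.
have [m [im cm bm]] := expmx_loop_dominated i mM MB f2.
apply: (shardy_dominated (h_ := fun N t => (expmx_part (M (cis t)) N *m f (cis t)) i 0)
  (m := m)) => //.
- move=> N; have -> : (fun t => (expmx_part (M (cis t)) N *m f (cis t)) i 0) =
     (fun t => \sum_(k < N) k`!%:R^-1 * (M (cis t) ^+ k *m f (cis t)) i 0).
    apply/funext => t; rewrite /expmx_part mulmx_suml summxE.
    by apply: eq_bigr => k _; rewrite -scalemxAl mxE.
  by apply: shardy_sum => k; apply: shardyZ; have /HplusE := MX k; exact.
- exact: csquare_loop (mult_loop_expmx mM MB) f2 i.
Qed.

Lemma exprmxZ (z : R[i]) (A : 'M[R[i]]_n) k : (z *: A) ^+ k = z ^+ k *: A ^+ k.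
Proof.
elim: k => [|k IH]; first by rewrite !expr0 scale1r.
by rewrite !exprS IH -!mulmxE -scalemxAl -scalemxAr scalerA.
Qed.

(** Term by term integration makes the k-th Fourier coefficient of exp(z M) v a power series in z,
    with coefficients those of M^m v over m!. A vanishing Fourier coefficient at one z thus becomes
    a zero of that series. *)
Lemma fourier_expmx_series M B (v : 'cV[R[i]]_n) (z : R[i]) (i : 'I_n) (k : int) :
  mult_loop M -> (forall t, mbound (M (cis t)) B) ->
  sfourier (fun t => (expmx (z *: M (cis t)) *m v) i 0) k = 0 ->
  pser_vanishes (fun m => sfourier (fun t => (M (cis t) ^+ m *m v) i 0) k / m`!%:R) z.
Proof.
move=> mM MB z0.
have zB t : mbound (z *: M (cis t)) (modc z * B).
  by move=> a b; rewrite mxE modcM ler_wpM2l ?modc_ge0//; exact: MB.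
have v2 j : csquare (fun t : R => v j 0) by exact: csquare_cst.
have [m [im cm bm]] := expmx_loop_dominated (f := fun=> v) i (mult_loopZ z mM) zB v2.
have mN N : cmeasurable (fun t => (expmx_part (z *: M (cis t)) N *m v) i 0).
  apply: csquare_measurable.
  exact: (csquare_loop (f := fun=> v) (mult_loop_expmx_part N (mult_loopZ z mM)) v2 i).
have := sfourier_dominated k mN (fun t _ => cm t) im (fun N t _ => bm N t).
rewrite z0 /pser_vanishes.
set a := fun N => _; set b := fun N => modc (pser _ _ _); suff -> : b = a by [].
apply/funext => N; rewrite /a /b subr0 /pser; congr modc.
have -> : (fun t => (expmx_part (z *: M (cis t)) N *m v) i 0) =
     (fun t => \sum_(k < N) (k`!%:R^-1 * z ^+ k) * (M (cis t) ^+ k *m v) i 0).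
  apply/funext => t; rewrite /expmx_part mulmx_suml summxE.
  by apply: eq_bigr => l _; rewrite exprmxZ scalerA -scalemxAl mxE.
have X2 l : csquare (fun t => (M (cis t) ^+ l *m v) i 0).
  exact: (csquare_loop (f := fun=> v) (mult_loopX l mM) v2 i).
rewrite sfourier_sum; last by move=> l; exact: csquareZ.
by apply: eq_bigr => l _; rewrite sfourierZ//; ring.
Qed.

End LoopsOnHardySpace.

(** * The exponential of a Laurent loop and its l^(-1) coefficient *)

Section LaurentLoops.
Variables (R : realType) (n d : nat) (xi : int -> 'M[R[i]]_n).

Lemma laurent_bound : exists B, forall l, mbound (laurent d xi l) B.
Proof.
exists (\sum_(j < d.+2) \sum_a \sum_b modc (xi (j%:Z - 1) a b)) => l a b.
rewrite summxE (le_trans (ler_modc_sum _ _ _))//; apply: ler_sum => j _.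
rewrite mxE modcM modc_exprz modc_circle exp1rz mul1r.
rewrite (bigD1 a)//= (bigD1 b)//= -addrA lerDl addr_ge0 ?sumr_ge0// => k _.
  exact: modc_ge0.
by rewrite sumr_ge0// => k' _; exact: modc_ge0.
Qed.

Lemma laurent_mulmx (l : circle R) (v : 'cV[R[i]]_n) i :
  (laurent d xi l *m v) i 0 =
  \sum_(j < d.+2) val l ^ (j%:Z - 1) * (xi (j%:Z - 1) *m v) i 0.
Proof.
rewrite /laurent mulmx_suml summxE; apply: eq_bigr => j _.
by rewrite -scalemxAl mxE.
Qed.

Lemma mult_loop_laurent : mult_loop (laurent d xi).
Proof.
move=> i j; have -> : (fun t => laurent d xi (cis t) i j) =
  (fun t => \sum_(k < d.+2) val (cis t) ^ (k%:Z - 1) * xi (k%:Z - 1) i j).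
  by apply/funext => t; rewrite summxE; apply: eq_bigr => k _; rewrite mxE.
apply: cmultiplier_sum => k; apply: cmultiplierM; last exact: cmultiplier_cst.
exact: cmultiplier_cis.
Qed.

Lemma fourier_laurent (v : 'cV[R[i]]_n) i :
  sfourier (fun t => (laurent d xi (cis t) *m v) i 0) (- 1) = (xi (- 1) *m v) i 0.
Proof.
have -> : (fun t => (laurent d xi (cis t) *m v) i 0) =
  (fun t => \sum_(j < d.+2) (xi (j%:Z - 1) *m v) i 0 * val (cis t) ^ (j%:Z - 1)).
  by apply/funext => t; rewrite laurent_mulmx; apply: eq_bigr => j _; rewrite mulrC.
rewrite sfourier_sum; last first.
  move=> j; apply: csquareZ; apply: csquare_multiplier; exact: cmultiplier_cis.
rewrite big_ord_recl /= sfourier_cis sub0r eqxx big1 ?addr0// => j _.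
by rewrite sfourier_cis -[X in X == _]sub0r (inj_eq (addIr _)).
Qed.

Lemma Hplus_laurent g : xi (- 1) = 0 -> Hplus g ->
  Hplus (fun l => laurent d xi l *m g l).
Proof.
move=> x0 /HplusE gH; apply/HplusE => i.
have -> : (fun t => (laurent d xi (cis t) *m g (cis t)) i 0) =
  (fun t => \sum_(j < d.+2)
     val (cis t) ^ (j%:Z - 1) * \sum_k xi (j%:Z - 1) i k * g (cis t) k 0).
  apply/funext => t; rewrite laurent_mulmx; apply: eq_bigr => j _.
  by rewrite mxE.
apply: shardy_sum => -[[|j] jd].
  (* Index 0 carries l^(-1), whose coefficient vanishes by [x0]; the remaining exponents are
     nonnegative. *)
  rewrite (_ : (fun t => _) = fun=> 0); first exact: shardy_cst.
  by apply/funext => t; rewrite /= sub0r x0 big1 ?mulr0// => k _; rewrite mxE mul0r.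
apply: shardy_shift; first by rewrite /= -addn1 PoszD addrK.
by apply: shardy_sum => k; exact: shardyZ.
Qed.

(** For fixed i and j let c_k be the l^(-1) coefficient of the i-th component of xi^k e_j. Then c_1
    is an entry of xi_(-1), c_k grows at most like (n B)^k, and the hypothesis puts zeros of the
    series with coefficients c_k / k! at lattice points. *)
Lemma laurent_principal_part_eq0 (w1 w2 : R[i]) : lattice_basis w1 w2 ->
  (forall (m1 m2 : nat) (j : 'I_n), Hplus (fun l =>
     expmx ((m1%:R * w1 + m2%:R * w2) *: laurent d xi l) *m delta_mx j 0)) ->
  xi (- 1) = 0.
Proof.
move=> hw H; have [B xB] := laurent_bound.
apply/matrixP => i j; rewrite mxE.
pose v : 'cV[R[i]]_n := delta_mx j 0.
have <- : (xi (- 1) *m v) i 0 = xi (- 1) i j by rewrite -colE mxE.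
rewrite -fourier_laurent.
pose c k := sfourier (fun t => (laurent d xi (cis t) ^+ k *m v) i 0) (- 1).
have -> : sfourier (fun t => (laurent d xi (cis t) *m v) i 0) (- 1) = c 1%N by [].
have B0 := mbound_ge0 (xB (cis 0)) i.
apply: (@exp_type_lattice_zeros R c
  (modc ((2 * pi)^-1)%:C * (2 * fine (lebesgue_measure (`[0, 2 * pi]%classic : set R))))
  (n%:R * B) w1 w2) => //.
- by rewrite !mulr_ge0 ?modc_ge0// fine_ge0.
- by rewrite mulr_ge0.
- move=> k; apply: modc_sfourier_le.
    apply: (csquare_loop (f := fun=> v) (mult_loopX k mult_loop_laurent)) => a.
    exact: csquare_cst.
  by move=> t; rewrite -colE mxE; exact: mboundX.
- move=> m1 m2; apply: (fourier_expmx_series mult_loop_laurent) => //.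
  by have /HplusE/(_ i)[_ ->] := H m1 m2 j.
Qed.

(** Equality, and not just inclusion, because the inverse exp(- z xi) preserves H_+ too. *)
Lemma loop_Hplus_expmx_laurent (z : R[i]) : xi (- 1) = 0 ->
  loop_Hplus (fun l => expmx (z *: laurent d xi l)) = @Hplus R n.
Proof.
move=> x0; have [B xB] := laurent_bound.
have zB w l : mbound (w *: laurent d xi l) (modc w * B).
  by move=> a b; rewrite mxE modcM ler_wpM2l ?modc_ge0//; exact: xB.
have expH w f : Hplus f -> Hplus (fun l => expmx (w *: laurent d xi l) *m f l).
  apply: Hplus_expmx (mult_loopZ w mult_loop_laurent) (fun t => zB w (cis t)) _.
  move=> g gH; have /HplusE H := Hplus_laurent x0 gH; apply/HplusE => i.
  have := shardyZ w (H i); congr shardy; apply/funext => t.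
  by rewrite -scalemxAl [RHS]mxE.
apply/seteqP; split=> [_ [f fH <-]|h hH]; first exact: expH.
exists (fun l => expmx (- (z *: laurent d xi l)) *m h l).
  rewrite (_ : (fun l => _) = fun l => expmx (- z *: laurent d xi l) *m h l).
    exact: expH.
  by apply/funext => l; rewrite scaleNr.
by apply/funext => l; rewrite mulmxA (mulmx_expmxN (zB z l)) mul1mx.
Qed.

End LaurentLoops.

(** * Derivatives of matrix-valued functions *)

Section Calculus.
Variable R : realType.
Implicit Types (q v : R * R).

Definition cderive (f : R * R -> R[i]) q v (d : R[i]) :=
  is_derive q v (fun x => complex.Re (f x)) (complex.Re d) /\
  is_derive q v (fun x => complex.Im (f x)) (complex.Im d).

Lemma cderive_cst (c : R[i]) q v : cderive (fun=> c) q v 0.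
Proof. by split; exact: is_derive_cst. Qed.

Lemma cderiveD f g q v df dg : cderive f q v df -> cderive g q v dg ->
  cderive (fun x => f x + g x) q v (df + dg).
Proof.
move=> [f1 f2] [g1 g2]; split.
  rewrite (_ : (fun x => _) = (fun x => complex.Re (f x)) + (fun x => complex.Re (g x))).
    by rewrite ReD; exact: is_deriveD.
  by apply/funext => x; rewrite ReD.
rewrite (_ : (fun x => _) = (fun x => complex.Im (f x)) + (fun x => complex.Im (g x))).
  by rewrite ImD; exact: is_deriveD.
by apply/funext => x; rewrite ImD.
Qed.

Lemma cderiveM f g q v df dg : cderive f q v df -> cderive g q v dg ->
  cderive (fun x => f x * g x) q v (df * g q + f q * dg).
Proof.
move=> [f1 f2] [g1 g2]; split.
  have := is_deriveB (is_deriveM f1 g1) (is_deriveM f2 g2).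
  rewrite (_ : (fun x => complex.Re (f x * g x)) =
    (fun x => complex.Re (f x)) * (fun x => complex.Re (g x)) -
    (fun x => complex.Im (f x)) * (fun x => complex.Im (g x))); last first.
    by apply/funext => x; rewrite ReM.
  congr is_derive; rewrite ReD !ReM /GRing.scale /=; ring.
have := is_deriveD (is_deriveM f1 g2) (is_deriveM f2 g1).
rewrite (_ : (fun x => complex.Im (f x * g x)) =
  (fun x => complex.Re (f x)) * (fun x => complex.Im (g x)) +
  (fun x => complex.Im (f x)) * (fun x => complex.Re (g x))); last first.
  by apply/funext => x; rewrite ImM.
congr is_derive; rewrite ImD !ImM /GRing.scale /=; ring.
Qed.

Lemma cderive_conj f q v df : cderive f q v df ->
  cderive (fun x => Num.conj (f x)) q v (Num.conj df).
Proof.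
move=> [f1 f2]; split.
  rewrite (_ : (fun x => _) = (fun x => complex.Re (f x))).
    by case: (df) f1.
  by apply/funext => x; case: (f x).
rewrite (_ : (fun x => _) = - (fun x => complex.Im (f x))).
  by case: (df) f2 => a b f2; exact: is_deriveN.
by apply/funext => x /=; rewrite [RHS]/(- complex.Im (f x)); case: (f x).
Qed.

Lemma cderive_sum (J : Type) (r : seq J) (f : J -> R * R -> R[i]) q v df :
  (forall j, cderive (f j) q v (df j)) ->
  cderive (fun x => \sum_(j <- r) f j x) q v (\sum_(j <- r) df j).
Proof.
move=> H; elim: r => [|j r IH].
  rewrite big_nil (_ : (fun x => _) = fun=> 0); first exact: cderive_cst.
  by apply/funext => x; rewrite big_nil.
rewrite big_cons (_ : (fun x => _) = fun x => f j x + \sum_(i <- r) f i x).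
  exact: cderiveD.
by apply/funext => x; rewrite big_cons.
Qed.

Definition pt (z : R[i]) : R * R := (complex.Re z, complex.Im z).

Lemma plane_pt z : plane (pt z) = z.
Proof. by case: z. Qed.

Definition mderive m p (F : R[i] -> 'M[R[i]]_(m, p)) z v (D : 'M[R[i]]_(m, p)) :=
  forall i j, cderive (fun q => F (plane q) i j) (pt z) v (D i j).

(** [dir_deriv] has a value even where no derivative exists; this certifies a true derivative, as
    the product and adjoint rules require. *)
Definition mderivable m p (F : R[i] -> 'M[R[i]]_(m, p)) :=
  forall z v, mderive F z v (dir_deriv v F z).

Lemma mderive_dir m p (F : R[i] -> 'M[R[i]]_(m, p)) z v D :
  mderive F z v D -> dir_deriv v F z = D.
Proof.
move=> FD; apply/matrixP => i j; rewrite mxE; have [h1 h2] := FD i j.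
by rewrite (@derive_val _ _ _ _ _ _ _ h1) (@derive_val _ _ _ _ _ _ _ h2); case: (D i j).
Qed.

Lemma mderivableP m p (F : R[i] -> 'M[R[i]]_(m, p)) :
  (forall z v, exists D, mderive F z v D) -> mderivable F.
Proof. by move=> H z v; have [D FD] := H z v; rewrite (mderive_dir FD). Qed.

Lemma smooth_mderivable m p (F : R[i] -> 'M[R[i]]_(m, p)) :
  smooth F -> mderivable F.
Proof.
move=> sF z v i j; rewrite mxE; have [h1 h2] := sF i j.
have [_ /(_ v)[d1 _]] := h1 1%N; have [_ /(_ v)[d2 _]] := h2 1%N.
by split; apply: DeriveDef => //.
Qed.

Lemma mderive_cst m p (C : 'M[R[i]]_(m, p)) z v : mderive (fun=> C) z v 0.
Proof. by move=> i j; rewrite mxE; exact: cderive_cst. Qed.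

Lemma mderiveD m p (F G : R[i] -> 'M[R[i]]_(m, p)) z v D E :
  mderive F z v D -> mderive G z v E -> mderive (fun x => F x + G x) z v (D + E).
Proof.
move=> FD GE i j; rewrite mxE (_ : (fun q => _) =
  fun q => F (plane q) i j + G (plane q) i j); first exact: cderiveD.
by apply/funext => q; rewrite mxE.
Qed.

Lemma mderiveM m p r (F : R[i] -> 'M[R[i]]_(m, p)) (G : R[i] -> 'M[R[i]]_(p, r))
    z v D E : mderive F z v D -> mderive G z v E ->
  mderive (fun x => F x *m G x) z v (D *m G z + F z *m E).
Proof.
move=> FD GE i j; rewrite !mxE -big_split /= (_ : (fun q => _) =
  fun q => \sum_k F (plane q) i k * G (plane q) k j); last first.
  by apply/funext => q; rewrite mxE.
apply: cderive_sum => k; have := cderiveM (FD i k) (GE k j).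
by rewrite plane_pt.
Qed.

Lemma mderive_adj m p (F : R[i] -> 'M[R[i]]_(m, p)) z v D :
  mderive F z v D -> mderive (fun x => (F x)^t*) z v (D^t*).
Proof.
move=> FD i j; rewrite !mxE (_ : (fun q => _) = fun q => Num.conj (F (plane q) j i)).
  exact: cderive_conj.
by apply/funext => q; rewrite !mxE.
Qed.

Lemma mderivable_cst m p (C : 'M[R[i]]_(m, p)) : mderivable (fun=> C).
Proof. by apply: mderivableP => z v; exists 0; exact: mderive_cst. Qed.

Lemma mderivableD m p (F G : R[i] -> 'M[R[i]]_(m, p)) :
  mderivable F -> mderivable G -> mderivable (fun x => F x + G x).
Proof.
move=> dF dG; apply: mderivableP => z v; eexists; exact: mderiveD (dF z v) (dG z v).
Qed.

Lemma mderivableM m p r (F : R[i] -> 'M[R[i]]_(m, p)) (G : R[i] -> 'M[R[i]]_(p, r)) :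
  mderivable F -> mderivable G -> mderivable (fun x => F x *m G x).
Proof.
move=> dF dG; apply: mderivableP => z v; eexists; exact: mderiveM (dF z v) (dG z v).
Qed.

Lemma mderivable_adj m p (F : R[i] -> 'M[R[i]]_(m, p)) :
  mderivable F -> mderivable (fun x => (F x)^t*).
Proof.
move=> dF; apply: mderivableP => z v; eexists; exact: mderive_adj (dF z v).
Qed.

Lemma dz_cst m p (C : 'M[R[i]]_(m, p)) z : dz (fun=> C) z = 0.
Proof. by rewrite /dz !(mderive_dir (mderive_cst _ _ _)) scaler0 subrr scaler0. Qed.

Lemma dzbar_cst m p (C : 'M[R[i]]_(m, p)) z : dzbar (fun=> C) z = 0.
Proof. by rewrite /dzbar !(mderive_dir (mderive_cst _ _ _)) scaler0 addr0 scaler0. Qed.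

Lemma dzD m p (F G : R[i] -> 'M[R[i]]_(m, p)) z : mderivable F -> mderivable G ->
  dz (fun x => F x + G x) z = dz F z + dz G z.
Proof.
move=> dF dG; rewrite /dz !(mderive_dir (mderiveD (dF _ _) (dG _ _))).
by rewrite -scalerDr [(0 +i* 1) *: (_ + _)]scalerDr opprD addrACA.
Qed.

Lemma dzM m p r (F : R[i] -> 'M[R[i]]_(m, p)) (G : R[i] -> 'M[R[i]]_(p, r)) z :
  mderivable F -> mderivable G ->
  dz (fun x => F x *m G x) z = dz F z *m G z + F z *m dz G z.
Proof.
move=> dF dG; rewrite /dz !(mderive_dir (mderiveM (dF _ _) (dG _ _))).
rewrite -scalemxAl -scalemxAr -scalerDr mulmxBl mulmxBr -scalemxAl -scalemxAr.
by rewrite [(0 +i* 1) *: (_ + _)]scalerDr opprD addrACA.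
Qed.

Lemma dzbarM m p r (F : R[i] -> 'M[R[i]]_(m, p)) (G : R[i] -> 'M[R[i]]_(p, r)) z :
  mderivable F -> mderivable G ->
  dzbar (fun x => F x *m G x) z = dzbar F z *m G z + F z *m dzbar G z.
Proof.
move=> dF dG; rewrite /dzbar !(mderive_dir (mderiveM (dF _ _) (dG _ _))).
rewrite -scalemxAl -scalemxAr -scalerDr mulmxDl mulmxDr -scalemxAl -scalemxAr.
by rewrite [(0 +i* 1) *: (_ + _)]scalerDr addrACA.
Qed.

Lemma dz_adj m p (F : R[i] -> 'M[R[i]]_(m, p)) z : mderivable F ->
  dz (fun x => (F x)^t*) z = (dzbar F z)^t*.
Proof.
move=> dF; rewrite /dz /dzbar !(mderive_dir (mderive_adj (dF _ _))).
apply/matrixP => i j; rewrite !mxE rmorphM rmorphD rmorphM /= fmorphV rmorph_nat.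
congr (_ * (_ + _)); rewrite -mulNr; congr (_ * _).
by apply/eqP; rewrite eq_complex /= oppr0 !eqxx.
Qed.

Lemma is_derive_line (f : R * R -> R) q v (y df : R) :
  is_derive (y *: v + q) v f df ->
  is_derive y (1 : R) (fun x : R => f (x *: v + q)) df.
Proof.
move=> [f1 f2].
have E : (fun h : R => h^-1 *: (((fun x : R => f (x *: v + q)) \o shift y) (h *: (1 : R)) -
      f (y *: v + q))) =
    (fun h : R => h^-1 *: ((f \o shift (y *: v + q)) (h *: v) - f (y *: v + q))).
  apply/funext => h /=; do 3 f_equal.
  by rewrite /GRing.scale /= mulr1 -/(GRing.scale _ _) scalerDl addrA.
split; first by rewrite /derivable E.
by rewrite /derive E.
Qed.

(** Every point is reached from the origin along a vertical and then a horizontal line, so the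
    one-variable statement applies twice. *)
Lemma cst_of_derive0 (f : R * R -> R) : (forall q, is_derive q (1, 0) f 0) ->
  (forall q, is_derive q (0, 1) f 0) -> forall q, f q = f (0, 0).
Proof.
move=> f1 f2.
have line v : (forall q, is_derive q v f 0) ->
    forall q (x : R), f (x *: v + q) = f q.
  move=> fv q x.
  have := is_derive_0_is_cst x 0 (fun y => is_derive_line (fv (y *: v + q))).
  by rewrite scale0r add0r.
case=> x y; have <- := line _ f2 (0, 0) y.
have <- := line _ f1 (y *: (0, 1) + (0, 0)) x; congr f.
by apply/pair_equal_spec; split; rewrite /= !(scaler0, addr0, add0r);
  exact: esym (mulr1 _).
Qed.

Lemma cst_of_dz0 m p (F : R[i] -> 'M[R[i]]_(m, p)) : mderivable F ->
  (forall z, dz F z = 0) -> (forall z, dzbar F z = 0) -> forall z, F z = F 0.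
Proof.
move=> dF F1 F2.
have half : (2^-1 : R[i]) != 0 by rewrite invr_neq0.
have i_neq0 : (0 +i* 1 : R[i]) != 0 by rewrite eq_complex /= oner_eq0 andbF.
have [d10 d01] : (forall z, dir_deriv (1, 0) F z = 0) /\
    (forall z, dir_deriv (0, 1) F z = 0).
  suff H z : dir_deriv (1, 0) F z = 0 /\ dir_deriv (0, 1) F z = 0.
    by split=> z; case: (H z).
  have /eqP := F1 z; have /eqP := F2 z; rewrite /dz /dzbar.
  rewrite !scaler_eq0 (negPf half) /= addr_eq0 => /eqP -> /eqP.
  move=> /eqP; rewrite -opprD oppr_eq0 -mulr2n -scaler_nat !scaler_eq0.
  rewrite pnatr_eq0 (negPf i_neq0) /= => /eqP ->.
  by rewrite scaler0 oppr0.
move=> z; apply/matrixP => i j; apply/eqP; rewrite eq_complex.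
have D v q : dir_deriv v F (plane q) = 0 -> cderive (fun q => F (plane q) i j) q v 0.
  by move=> H; have := dF (plane q) v i j; rewrite H mxE; case: (q).
have -> : F 0 = F (plane (0, 0)) by [].
rewrite -(plane_pt z).
apply/andP; split; apply/eqP.
  apply: (@cst_of_derive0 (fun q => complex.Re (F (plane q) i j))) => q.
    by have [] := D _ q (d10 _).
  by have [] := D _ q (d01 _).
apply: (@cst_of_derive0 (fun q => complex.Im (F (plane q) i j))) => q.
  by have [] := D _ q (d10 _).
by have [] := D _ q (d01 _).
Qed.

End Calculus.

(** * Unitons and extended solutions *)

#[local] Opaque dz dzbar.

Section Unitons.
Variables (R : realType) (n : nat).
Implicit Types (F Phi alpha phi : R[i] -> 'M[R[i]]_n).

Lemma adjM m p r (A : 'M[R[i]]_(m, p)) (B : 'M[R[i]]_(p, r)) :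
  (A *m B)^t* = B^t* *m A^t*.
Proof. by rewrite trmx_mul map_mxM. Qed.

Lemma adjK m p (A : 'M[R[i]]_(m, p)) : A^t*^t* = A.
Proof. by apply/matrixP => i j; rewrite !mxE conjCK. Qed.

Lemma adjD m p (A B : 'M[R[i]]_(m, p)) : (A + B)^t* = A^t* + B^t*.
Proof. by rewrite linearD map_mxD. Qed.

Lemma adjZ m p (a : R[i]) (A : 'M[R[i]]_(m, p)) : (a *: A)^t* = Num.conj a *: A^t*.
Proof. by apply/matrixP => i j; rewrite !mxE rmorphM. Qed.

Lemma adjN m p (A : 'M[R[i]]_(m, p)) : (- A)^t* = - A^t*.
Proof. by apply/matrixP => i j; rewrite !mxE rmorphN. Qed.

Lemma mulmx_col m p r (A : 'M[R[i]]_(m, p)) (B : 'M[R[i]]_(p, r)) j :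
  A *m col j B = col j (A *m B).
Proof. by rewrite !colE mulmxA. Qed.

Lemma eq_cols m p (A B : 'M[R[i]]_(m, p)) : (forall j, col j A = col j B) -> A = B.
Proof.
by move=> AB; apply/matrixP => i j; have /matrixP/(_ i 0) := AB j; rewrite !mxE.
Qed.

Lemma unitary_mulV (A : 'M[R[i]]_n) : A \is unitarymx -> A^t* *m A = 1%:M.
Proof. by move=> /unitarymxP /mulmx1C. Qed.

Lemma unitary_inv (A : 'M[R[i]]_n) : A \is unitarymx -> invmx A = A^t*.
Proof.
move=> uA; rewrite -[LHS]mul1mx -(unitary_mulV uA) -mulmxA mulmxV ?mulmx1//.
exact: unitarymx_unit.
Qed.

Lemma dz_adj_unitary F z : mderivable F -> (forall x, F x \is unitarymx) ->
  dz (fun x => (F x)^t*) z = - ((F z)^t* *m dz F z *m (F z)^t*).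
Proof.
move=> dF uF; have := @dz_cst R n n 1%:M z.
have -> : (fun=> 1%:M) = (fun x => (F x)^t* *m F x).
  by apply/funext => x; rewrite unitary_mulV.
rewrite dzM//; last exact: mderivable_adj.
move=> /(congr1 (fun M => M *m (F z)^t*)); rewrite mul0mx mulmxDl -(mulmxA _ (F z)).
have /unitarymxP -> := uF z; rewrite mulmx1 => /eqP.
by rewrite addr_eq0 => /eqP.
Qed.

Lemma dzbar_unitary F z : mderivable F -> (forall x, F x \is unitarymx) ->
  dzbar F z = - (F z *m (dz F z)^t* *m F z).
Proof.
move=> dF uF; rewrite -[LHS]adjK -(dz_adj _ dF) dz_adj_unitary//.
by rewrite adjN !adjM adjK mulmxA.
Qed.

(** Differentiating F^* F = 1 expresses [dzbar F] through the adjoint of [dz F]. This is what allows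
    only the z-half of the extended equations to be tracked. *)
Lemma cst_of_dz0_unitary F : mderivable F -> (forall x, F x \is unitarymx) ->
  (forall z, dz F z = 0) -> forall z, F z = F 0.
Proof.
move=> dF uF F0; apply: cst_of_dz0 => // z.
by rewrite dzbar_unitary// F0 trmx0 map_mx0 mulmx0 mul0mx oppr0.
Qed.

(** Lets the antiholomorphic uniton condition be rewritten in terms of [Az] alone. *)
Lemma Azbar_adj phi z : mderivable phi -> (forall x, phi x \is unitarymx) ->
  Azbar phi z = - (Az phi z)^t*.
Proof.
move=> dphi uphi; rewrite /Azbar /Az dzbar_unitary// !unitary_inv//.
move: (dz phi z) (uphi z) => D; move: (phi z) => P uP.
rewrite [in RHS]adjZ fmorphV rmorph_nat -[RHS]scalerN; congr (_ *: _).
rewrite (adjM _ D) (adjK P) mulmxN (mulmxA _ (P *m _)) (mulmxA _ P).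
by rewrite (unitary_mulV uP) mul1mx.
Qed.

Definition uniton_factor (l : R[i]) alpha (z : R[i]) : 'M[R[i]]_n :=
  alpha z + l *: (1%:M - alpha z).

Lemma cartan_factor alpha : cartan alpha = uniton_factor (-1) alpha.
Proof. by apply/funext => z; rewrite /cartan /uniton_factor scaleN1r. Qed.

Lemma uniton_factorE l alpha :
  uniton_factor l alpha = fun z => l%:M + (1 - l)%:M *m alpha z.
Proof.
apply/funext => z; rewrite /uniton_factor mul_scalar_mx scalerBr scalerBl scale1r.
by rewrite scalemx1 addrCA.
Qed.

Lemma mderivable_factor l alpha : mderivable alpha -> mderivable (uniton_factor l alpha).
Proof.
move=> da; rewrite uniton_factorE; apply: mderivableD; first exact: mderivable_cst.
by apply: mderivableM => //; exact: mderivable_cst.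
Qed.

Lemma dz_factor l alpha z : mderivable alpha ->
  dz (uniton_factor l alpha) z = (1 - l) *: dz alpha z.
Proof.
move=> da; have dc (C : 'M[R[i]]_n) := mderivable_cst C.
rewrite uniton_factorE dzD ?dz_cst ?add0r//; last exact: mderivableM.
by rewrite dzM// dz_cst mul0mx add0r mul_scalar_mx.
Qed.

Section OneUniton.
Variables (w1 w2 : R[i]) (phi alpha : R[i] -> 'M[R[i]]_n).
Hypothesis uni : uniton w1 w2 phi alpha.
Local Notation A := (Az phi).

Lemma uniton_smooth :
  [/\ mderivable phi, forall x, phi x \is unitarymx & mderivable alpha].
Proof.
by have [[sphi uphi _] [k [salpha _ _]] _] := uni; split=> //; exact: smooth_mderivable.
Qed.

Lemma uniton_proj z : alpha z *m alpha z = alpha z /\ (alpha z)^t* = alpha z.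
Proof. by have [_ [k [_ _ /(_ z)[pp pa _]]] _] := uni. Qed.

(** The columns of the projection are global periodic sections that span [alpha] at every point.
    Testing the uniton conditions on them turns closure of a space of sections into matrix
    identities. *)
Lemma section_col j : is_section w1 w2 alpha (fun z => col j (alpha z)).
Proof.
have [_ [k [salpha palpha _]] _] := uni; split.
- move=> a b.
  have -> : (fun q : R * R => complex.Re (col j (alpha (plane q)) a b)) =
      fun q => complex.Re (alpha (plane q) a j) by apply/funext => q; rewrite mxE.
  have -> : (fun q : R * R => complex.Im (col j (alpha (plane q)) a b)) =
      fun q => complex.Im (alpha (plane q) a j) by apply/funext => q; rewrite mxE.
  exact: salpha.
- by move=> z; have [-> ->] := palpha z.
- by move=> z; rewrite mulmx_col; have [->] := uniton_proj z.
Qed.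

Lemma dzbar_col (F : R[i] -> 'M[R[i]]_n) j z : mderivable F ->
  dzbar (fun z => col j (F z)) z = col j (dzbar F z).
Proof.
move=> dF; have -> : (fun z => col j (F z)) = (fun z => F z *m delta_mx j 0).
  by apply/funext => x; rewrite colE.
by rewrite dzbarM ?dzbar_cst ?mulmx0 ?addr0 -?colE//; exact: mderivable_cst.
Qed.

Lemma uniton_Az z : alpha z *m A z *m alpha z = A z *m alpha z.
Proof.
have [_ _ H] := uni; rewrite -mulmxA; apply: eq_cols => j.
have [_ [_ _ /(_ z)]] := H _ (section_col j).
by rewrite !mulmx_col.
Qed.

(** Closure under dzbar + A_zbar says that X = dzbar(pi) + A_zbar pi has values in [alpha]. Its
    adjoint is dz(pi) - pi A, so the condition reads X^* pi = X^*; it is combined with the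
    derivative of pi^2 = pi and with pi A pi = A pi. *)
Lemma uniton_dz z : alpha z *m dz alpha z = alpha z *m A z - A z *m alpha z.
Proof.
have [_ _ H] := uni; have [dphi uphi dalpha] := uniton_smooth.
have [pp pa] := uniton_proj z.
set p := alpha z in pp pa *; set X := dzbar alpha z + Azbar phi z *m p.
have pX : p *m X = X.
  apply: eq_cols => j.
  have [[_ _ /(_ z) /= +] _] := H _ (section_col j).
  by rewrite (dzbar_col j z dalpha) !mulmx_col -linearD /= mulmx_col.
have adj_dz : (dzbar alpha z)^t* = dz alpha z.
  rewrite -(dz_adj z dalpha); congr (dz _ z); apply/funext => x.
  by have [] := uniton_proj x.
have XE : X^t* = dz alpha z - p *m A z.
  rewrite /X Azbar_adj// -adj_dz.
  move: (dzbar alpha z) (A z) => D B.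
  by rewrite adjD adjM pa adjN adjK mulmxN.
have Xp : X^t* *m p = X^t* by rewrite -{2}pX adjM pa.
have dp : dz alpha z = dz alpha z *m p + p *m dz alpha z.
  rewrite -(dzM z dalpha dalpha); congr (dz _ z); apply/funext => x.
  by have [] := uniton_proj x.
have pAp := uniton_Az z; move: Xp; rewrite XE; rewrite -/p in pAp.
move: (dz alpha z) (A z) dp pAp => D B dp pAp.
rewrite mulmxBl pAp => E.
have -> : p *m D = D - D *m p by rewrite {2}dp addrC addKr.
have -> : D *m p = D - p *m B + B *m p by rewrite -E subrK.
by rewrite opprD opprB addrA addrCA subrr addr0.
Qed.

(** Holds because pi and 1 - pi are complementary idempotents. With m the conjugate of l it gives
    unitarity; with m = -1 it serves the passage to the next map. *)
Lemma factor_mul l m z :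
  uniton_factor l alpha z *m uniton_factor m alpha z = uniton_factor (l * m) alpha z.
Proof.
have [pp _] := uniton_proj z; rewrite /uniton_factor.
set p := alpha z in pp *; have pq : p *m (1%:M - p) = 0.
  by rewrite mulmxBr mulmx1 pp subrr.
have qp : (1%:M - p) *m p = 0 by rewrite mulmxBl mul1mx pp subrr.
have qq : (1%:M - p) *m (1%:M - p) = 1%:M - p.
  by rewrite mulmxBr mulmx1 qp subr0.
rewrite mulmxDl !mulmxDr pp -!scalemxAr -!scalemxAl pq qp qq.
by rewrite !scaler0 addr0 add0r scalerA mulrC.
Qed.

Lemma factor1 z : uniton_factor 1 alpha z = 1%:M.
Proof. by rewrite /uniton_factor scale1r addrC subrK. Qed.

Lemma factor_adj l z : (uniton_factor l alpha z)^t* = uniton_factor (Num.conj l) alpha z.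
Proof.
have [_ pa] := uniton_proj z.
by rewrite /uniton_factor adjD adjZ adjD adjN pa trmx1 map_mx1.
Qed.

Lemma factor_unitary l z : l * Num.conj l = 1 -> uniton_factor l alpha z \is unitarymx.
Proof. by move=> ll; apply/unitarymxP; rewrite factor_adj factor_mul ll factor1. Qed.

(** Q = pi - pi^perp is its own adjoint and inverse, and its derivative 2 dz(pi) cancels the half in
    [Az]. *)
Lemma uniton_Az_next z :
  Az (fun x => phi x *m cartan alpha x) z =
  cartan alpha z *m (A z *m cartan alpha z + dz alpha z).
Proof.
have [dphi uphi dalpha] := uniton_smooth; rewrite !cartan_factor.
have conjN1 : Num.conj (-1) = -1 :> R[i] by rewrite rmorphN1.
have uc x : phi x *m uniton_factor (-1) alpha x \is unitarymx.
  by apply: mul_unitarymx (uphi x) _; apply: factor_unitary; rewrite conjN1 mulrNN mulr1.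
rewrite /Az unitary_inv// adjM factor_adj conjN1 dzM//; last exact: mderivable_factor.
rewrite dz_factor// unitary_inv// opprK.
move: (uniton_factor _ _ _) (dz phi z) (dz alpha z) (phi z) (uphi z) => Q D E P uP.
have PPE : P^t* *m (P *m E) = E by rewrite mulmxA unitary_mulV// mul1mx.
have -> : Q *m P^t* *m (D *m Q + P *m ((1 + 1) *: E)) =
    Q *m P^t* *m (D *m Q) + (1 + 1) *: (Q *m E).
  by rewrite mulmxDr -!scalemxAr -(mulmxA Q _ (P *m E)) PPE.
rewrite scalerDr scalerA mulVf ?scale1r ?pnatr_eq0// mulmxDr; congr (_ + _).
by rewrite -scalemxAl -scalemxAr !mulmxA.
Qed.

(* Multiplication by [pi + l (1 - pi)] turns a solution of the extended equation for
   [phi] into one for [phi (pi - pi^perp)]; with [A = Az phi] this comes down to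
   [pi A pi = A pi] and [pi dz(pi) = pi A (1 - pi)], the two uniton conditions. *)
Lemma factor_extended l z (Psi : R[i] -> 'M[R[i]]_n) : l != 0 -> mderivable Psi ->
  dz Psi z = (1 - l^-1) *: (Psi z *m A z) ->
  dz (fun x => Psi x *m uniton_factor l alpha x) z =
  (1 - l^-1) *: (Psi z *m uniton_factor l alpha z *m
     Az (fun x => phi x *m cartan alpha x) z).
Proof.
move=> l0 dPsi PsiE; have [dphi uphi dalpha] := uniton_smooth.
rewrite (dzM z dPsi (mderivable_factor l dalpha)) (dz_factor l z dalpha) PsiE.
rewrite uniton_Az_next cartan_factor -!(mulmxA (Psi z)).
rewrite (mulmxA (uniton_factor l alpha z)) factor_mul mulrN1 /uniton_factor.
have pAp := uniton_Az z; have pdp := uniton_dz z; have [pp _] := uniton_proj z.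
move: (alpha z) (A z) (dz alpha z) (Psi z) pAp pdp pp => p B D P pAp pdp pp {PsiE}.
set Y := B *m _ + D.
have YE : Y = B *m p + B *m p - B + D.
  congr (_ + _); rewrite scaleN1r opprB mulmxDr mulmxBr mulmx1.
  by rewrite addrA.
(* Both uniton identities enter here, and the two terms p B cancel. *)
have pY : p *m Y = B *m p.
  by rewrite YE mulmxDr mulmxBr mulmxDr !mulmxA pAp pdp addrA subrK addrK.
have -> : (p + - l *: (1%:M - p)) *m Y = B *m p - l *: (Y - B *m p).
  by rewrite mulmxDl pY -scalemxAl mulmxBl mul1mx pY scaleNr.
have -> : Y - B *m p = B *m p - B + D.
  by rewrite YE -!addrA addrC -!addrA addNr addr0.
(* The derivative of the factor carries 1 - l and the extended equation 1 - l^-1; for nonzero l this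
   gives them a common factor. *)
have -> : (1 - l) = - l * (1 - l^-1) by rewrite mulrBr mulr1 mulNr divff// opprK addrC.
move: (1 - l^-1) => c.
rewrite -scalemxAl -(mulmxA P) -!scalemxAr [- l * _]mulrC -scalerA -scalerDr.
rewrite scalemxAr -mulmxDr; congr (_ *: (_ *m _)).
rewrite mulmxDr -scalemxAr mulmxBr mulmx1 !scalerDr !scalerN scaleNr.
by rewrite !opprD !opprK -addrA [l *: B - _]addrC.
Qed.

End OneUniton.
End Unitons.

(** * The extended solution attached to a uniton factorization *)

Section UnitonProduct.
Variables (R : realType) (n : nat) (w1 w2 : R[i]) (phi0 : 'M[R[i]]_n)
  (alpha : nat -> R[i] -> 'M[R[i]]_n).

(** The uniton factorization with -1 replaced by the loop parameter: at l = -1 its factors are the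
    [cartan] factors of [uniton_product]. *)
Fixpoint factor_product (l : R[i]) (s : nat) (z : R[i]) : 'M[R[i]]_n :=
  if s is s'.+1 then factor_product l s' z *m uniton_factor l (alpha s') z
  else phi0.

Lemma circle_conj (l : circle R) : val l * Num.conj (val l) = 1.
Proof. by rewrite -normCK (eqP (valP l)) expr1n. Qed.

Lemma factor_product_spec (s : nat) : phi0 \is unitarymx ->
  (forall i, (i < s)%N -> uniton w1 w2 (uniton_product phi0 alpha i) (alpha i)) ->
  forall l : circle R, let Psi := factor_product (val l) s in
  [/\ mderivable Psi, forall z, Psi z \is unitarymx &
   forall z, dz Psi z =
     (1 - (val l)^-1) *: (Psi z *m Az (uniton_product phi0 alpha s) z)].
Proof.
move=> u0; elim: s => [|s IH] unis l /=.
  split=> [|//|z]; first exact: mderivable_cst.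
  by rewrite /Az !dz_cst !mulmx0 scaler0 mulmx0 scaler0.
have [|dPsi uPsi PsiE] := IH _ l; first by move=> i si; apply: unis; exact: ltnW.
have us := unis s (ltnSn s); have [_ _ dalpha] := uniton_smooth us.
split.
- by apply: mderivableM dPsi _; exact: mderivable_factor.
- move=> z; apply: mul_unitarymx (uPsi z) _.
  exact: (factor_unitary us _ (circle_conj l)).
- by move=> z; rewrite (factor_extended us (circle_neq0 l) dPsi (PsiE z)).
Qed.

Lemma factor_product_periodic (s : nat) l :
  (forall i, (i < s)%N -> uniton w1 w2 (uniton_product phi0 alpha i) (alpha i)) ->
  Defs.periodic w1 w2 (factor_product l s).
Proof.
move=> unis z; elim: s unis => [//|s IH] unis /=.
have [|-> ->] := IH; first by move=> i si; apply: unis; exact: ltnW.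
have [_ [k [_ /(_ z)[p1 p2] _]] _] := unis s (ltnSn s).
by rewrite /uniton_factor p1 p2.
Qed.

End UnitonProduct.

(** * Laurent polynomials on the circle *)

Section LaurentPolynomials.
Variable R : realType.
Implicit Types (g h : circle R -> R[i]).

(** Encoded by an ordinary polynomial after clearing a power of l, so that sums and products reduce
    to operations in [{poly R[i]}]. *)
Definition laurent_poly g := exists (s : nat) (p : {poly R[i]}),
  forall l, g l * val l ^+ s = p.[val l].

Lemma laurent_poly_cst c : laurent_poly (fun=> c).
Proof. by exists 0%N, c%:P => l; rewrite hornerC expr0 mulr1. Qed.

Lemma laurent_poly_id : laurent_poly val.
Proof. by exists 0%N, 'X => l; rewrite hornerX expr0 mulr1. Qed.

Lemma laurent_polyD g h : laurent_poly g -> laurent_poly h ->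
  laurent_poly (fun l => g l + h l).
Proof.
move=> [s [p gp]] [t [q hq]]; exists (s + t)%N, (p * 'X^t + q * 'X^s) => l.
by rewrite !hornerE -gp -hq exprD; ring.
Qed.

Lemma laurent_polyM g h : laurent_poly g -> laurent_poly h ->
  laurent_poly (fun l => g l * h l).
Proof.
move=> [s [p gp]] [t [q hq]]; exists (s + t)%N, (p * q) => l.
by rewrite hornerM -gp -hq exprD; ring.
Qed.

Lemma laurent_poly_sum (J : Type) (r : seq J) (g : J -> circle R -> R[i]) :
  (forall j, laurent_poly (g j)) -> laurent_poly (fun l => \sum_(j <- r) g j l).
Proof.
move=> H; elim: r => [|j r IH].
  rewrite (_ : (fun l => _) = fun=> 0); first exact: laurent_poly_cst.
  by apply/funext => l; rewrite big_nil.
rewrite (_ : (fun l => _) = fun l => g j l + \sum_(i <- r) g i l).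
  exact: laurent_polyD.
by apply/funext => l; rewrite big_cons.
Qed.

Lemma laurent_poly_expand g : laurent_poly g ->
  exists (s K : nat) (c : nat -> R[i]),
    forall l, g l = \sum_(k < K) c k * val l ^ (k%:Z - s%:Z).
Proof.
move=> [s [p gp]]; exists s, (size p), (fun k => p`_k) => l.
have l0 := circle_neq0 l; have ls : val l ^+ s != 0 by rewrite expf_neq0.
apply: (mulIf ls); rewrite gp horner_coef mulr_suml; apply: eq_bigr => k _.
by rewrite -mulrA; congr (_ * _); rewrite !exprnP -exprzDr ?unitfE// subrK.
Qed.

Lemma conj_circle (l : circle R) : Num.conj (val l) = (val l)^-1.
Proof. by apply/esym/mulr1_eq/circle_conj. Qed.

Lemma conj_circle_exprz (l : circle R) (k : int) :
  Num.conj (val l ^ k) = val l ^ (- k).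
Proof. by rewrite fmorphXz -[LHS]/(Num.conj (val l) ^ k) conj_circle exprz_inv. Qed.

Lemma conj_laurent_sum (l : circle R) (s K : nat) (c : nat -> R[i]) :
  Num.conj (\sum_(k < K) c k * val l ^ (k%:Z - s%:Z)) =
  \sum_(k < K) Num.conj (c k) * val l ^ (- (k%:Z - s%:Z)).
Proof.
rewrite rmorph_sum; apply: eq_bigr => k _.
by rewrite -conj_circle_exprz; exact: rmorphM.
Qed.

Lemma laurent_poly_conj g : laurent_poly g -> laurent_poly (fun l => Num.conj (g l)).
Proof.
move=> /laurent_poly_expand[s [K [c gE]]].
(* Conjugation sends l^(k - s) to l^(s - k); multiplying by l^K makes the exponent s + K - k,
   nonnegative since k < K. *)
exists K, (\sum_(k < K) (Num.conj (c k))%:P * 'X^(s + K - k)) => l.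
rewrite gE conj_laurent_sum mulr_suml horner_sum; apply: eq_bigr => k _.
have l0 := circle_neq0 l.
rewrite !hornerE -mulrA; congr (_ * _).
rewrite !exprnP -exprzDr ?unitfE//; congr (_ ^ _).
by rewrite opprB -subzn ?PoszD; [ring | rewrite (leq_trans (ltnW (ltn_ord k))) ?leq_addl].
Qed.

(** Membership of g in H_+ kills the coefficients of negative powers, membership of its conjugate
    those of positive powers. Only index [j = s], of exponent 0, survives, and the finite sum gives
    equality at every point. *)
Lemma laurent_poly_hardy_cst g : laurent_poly g ->
  shardy (fun t => g (cis t)) -> shardy (fun t => Num.conj (g (cis t))) ->
  forall t, g (cis t) = g (cis 0).
Proof.
move=> /laurent_poly_expand[s [K [c gE]]] [_ H1] [_ H2].
have cis2 (m : int) : csquare (fun t : R => val (cis t) ^ m).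
  exact/csquare_multiplier/cmultiplier_cis.
have F1 k : sfourier (fun t => g (cis t)) k =
    \sum_(j < K) if k == j%:Z - s%:Z then c j else 0.
  have -> : (fun t => g (cis t)) =
     (fun t => \sum_(j < K) c j * val (cis t) ^ (j%:Z - s%:Z)).
    by apply/funext => t; rewrite gE.
  rewrite sfourier_sum; last by move=> j; exact: csquareZ.
  by apply: eq_bigr => j _; rewrite sfourier_cis.
have F2 k : sfourier (fun t => Num.conj (g (cis t))) k =
    \sum_(j < K) if k == - (j%:Z - s%:Z) then Num.conj (c j) else 0.
  have -> : (fun t => Num.conj (g (cis t))) =
     (fun t => \sum_(j < K) Num.conj (c j) * val (cis t) ^ (- (j%:Z - s%:Z))).
    by apply/funext => t; rewrite gE conj_laurent_sum.
  rewrite sfourier_sum; last by move=> j; exact: csquareZ.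
  by apply: eq_bigr => j _; rewrite sfourier_cis.
have pick (i : 'I_K) (f : 'I_K -> R[i]) (e : 'I_K -> int) : injective e ->
    \sum_(j < K) (if e i == e j then f j else 0) = f i.
  move=> ei; rewrite (bigD1 i)//= eqxx big1 ?addr0// => j /negPf ji.
  by rewrite (inj_eq ei) eq_sym ji.
have c0 (j : 'I_K) : (j : nat) != s -> c j = 0.
  rewrite neq_ltn => /orP[js|sj].
    have := H1 (j%:Z - s%:Z); rewrite subr_lt0 ltz_nat js => /(_ isT).
    rewrite F1 (pick j (fun j : 'I_K => c j) (fun j : 'I_K => j%:Z - s%:Z))//.
    by move=> a b /addIr[/val_inj].
  have := H2 (- (j%:Z - s%:Z)); rewrite oppr_lt0 subr_gt0 ltz_nat sj => /(_ isT).
  rewrite F2 (pick j (fun j : 'I_K => Num.conj (c j)) (fun j : 'I_K => - (j%:Z - s%:Z))).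
    by move=> /eqP; rewrite conjC_eq0 => /eqP.
  by move=> a b /oppr_inj /addIr[/val_inj].
move=> t; rewrite !gE; apply: eq_bigr => j _.
have [->|js] := eqVneq (j : nat) s; first by rewrite subrr !expr0z.
rewrite (c0 j js); exact: etrans (mul0r _) (esym (mul0r _)).
Qed.

Lemma laurent_poly_mulmx m p r (F : circle R -> 'M[R[i]]_(m, p))
    (G : circle R -> 'M[R[i]]_(p, r)) :
  (forall i j, laurent_poly (fun l => F l i j)) ->
  (forall i j, laurent_poly (fun l => G l i j)) ->
  forall i j, laurent_poly (fun l => (F l *m G l) i j).
Proof.
move=> HF HG i j; rewrite (_ : (fun l => _) = fun l => \sum_k F l i k * G l k j).
  by apply: laurent_poly_sum => k; exact: laurent_polyM.
by apply/funext => l; rewrite mxE.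
Qed.

Lemma laurent_poly_adj m p (F : circle R -> 'M[R[i]]_(m, p)) :
  (forall i j, laurent_poly (fun l => F l i j)) ->
  forall i j, laurent_poly (fun l => (F l)^t* i j).
Proof.
move=> HF i j; rewrite (_ : (fun l => _) = fun l => Num.conj (F l j i)).
  exact: laurent_poly_conj.
by apply/funext => l; rewrite !mxE.
Qed.

Lemma laurent_poly_factor_product n (phi0 : 'M[R[i]]_n)
    (alpha : nat -> R[i] -> 'M[R[i]]_n) s z i j :
  laurent_poly (fun l => factor_product phi0 alpha (val l) s z i j).
Proof.
elim: s i j => [|s IH] i j; first exact: laurent_poly_cst.
apply: (laurent_poly_mulmx (F := fun l => factor_product phi0 alpha (val l) s z)
  (G := fun l => uniton_factor (val l) (alpha s) z)) => // a b.
rewrite (_ : (fun l => _) = fun l => alpha s z a b + val l * (1%:M - alpha s z) a b).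
  apply: laurent_polyD; first exact: laurent_poly_cst.
  by apply: laurent_polyM; [exact: laurent_poly_id | exact: laurent_poly_cst].
by apply/funext => l; rewrite !mxE.
Qed.

End LaurentPolynomials.

(** * Constants in H_+ and the exponential at the base point *)

Section FiniteType.
Variables (R : realType) (n : nat).

Lemma expmx0 : expmx (0 : 'M[R[i]]_n) = 1%:M.
Proof.
have b0 : mbound (0 : 'M[R[i]]_n) 0 by move=> a b; rewrite mxE modc0.
apply/matrixP => i j; apply/eqP; rewrite eq_sym -subr_eq0 -modc_eq0 eq_le modc_ge0 andbT.
apply: (cvgr_to_ge (expmx_cvg i j b0)); exists 1%N => //= N N0.
rewrite /expmx_part -(prednK N0) big_ord_recl expr0 big1 ?addr0.
  by rewrite invr1 scale1r.
by move=> k _; rewrite exprS mul0r scaler0.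
Qed.

Lemma Hplus_cst (v : 'cV[R[i]]_n) : Hplus (fun=> v).
Proof. by apply/HplusE => j; exact: shardy_cst. Qed.

End FiniteType.

(** [acos] reaches the upper half circle and its opposite the lower half. Smoothness of extended
    solutions is phrased in the angle, so results at [cis t] are carried to all l this way. *)
Lemma cis_surj (R : realType) (l : circle R) : exists t, l = cis t.
Proof.
case: l => -[a b] ab.
have ab1 : a ^+ 2 + b ^+ 2 = 1.
  have E : modc (a +i* b) = 1 := modc_circle (exist _ (a +i* b) ab).
  by have := modc_sqr (a +i* b); rewrite E expr1n.
have a1 : -1 <= a <= 1.
  rewrite -ler_norml -(ler_pXn2r (ltn0Sn 1)) ?nnegrE// expr1n real_normK ?num_real//.
  by rewrite -ab1 lerDl sqr_ge0.
have ca : cos (acos a) = a by rewrite acosK.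
have sa : sin (acos a) = `|b|.
  by rewrite sin_acos// -ab1 addrC addKr sqrtr_sqr.
have [b0|b0] := leP 0 b.
  exists (acos a); apply: val_inj => /=.
  by rewrite ca sa ger0_norm.
exists (- acos a); apply: val_inj => /=.
by rewrite cosN sinN ca sa ltr0_norm ?opprK.
Qed.

(** * Comparison of extended solutions of one map *)

Section ExtendedSolutions.
Variables (R : realType) (n : nat).
Implicit Types (Phi : circle R -> R[i] -> 'M[R[i]]_n).

Lemma is_derive_snd (f : R * (R * R) -> R) (t : R) (q v : R * R) (df : R) :
  is_derive (t, q) (0, v) f df -> is_derive q v (fun x => f (t, x)) df.
Proof.
move=> [f1 f2].
have E : (fun h : R => h^-1 *: (((fun x => f (t, x)) \o shift q) (h *: v) - f (t, q))) =
    (fun h : R => h^-1 *: ((f \o shift (t, q)) (h *: (0, v)) - f (t, q))).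
  apply/funext => h /=; do 3 f_equal.
  by apply/pair_equal_spec; split; rewrite //= scaler0 add0r.
split; first by rewrite /derivable E.
by rewrite /derive E.
Qed.

Lemma extended_solution_mderivable Phi (t : R) : extended_solution Phi ->
  mderivable (Phi (cis t)).
Proof.
move=> [sPhi _ _ _] z v i j; rewrite mxE; have [h1 h2] := sPhi i j.
have [_ /(_ (0, v))[d1 _]] := h1 1%N; have [_ /(_ (0, v))[d2 _]] := h2 1%N.
have e1 := is_derive_snd (DeriveDef (d1 (t, pt z)) erefl).
have e2 := is_derive_snd (DeriveDef (d2 (t, pt z)) erefl).
split => /=.
  by apply: DeriveDef => //; case: e1.
by apply: DeriveDef => //; case: e2.
Qed.

(** The unspecified matrix A is read off at l = -1: there 1 - l^-1 = 2 matches the half in [Az], and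
    Phi is phi up to a constant unitary left factor, which drops out. *)
Lemma extended_solution_dz Phi phi : extended_solution Phi -> associated Phi phi ->
  mderivable phi -> (forall z, phi z \is unitarymx) ->
  forall t z, dz (Phi (cis t)) z =
    (1 - (val (cis t))^-1) *: (Phi (cis t) z *m Az phi z).
Proof.
move=> ePhi [u uu Pu] dphi uphi t z; have [_ uPhi _ [A [B AB]]] := ePhi.
have cpi : val (cis (pi : R)) = -1.
  by apply/eqP; rewrite eq_complex /= cospi sinpi oppr0 !eqxx.
have AE : A z = Az phi z.
  have [+ _] := AB (cis pi) z; rewrite cpi.
  rewrite (_ : Phi (cis pi) = fun x => u *m phi x); last first.
    by apply/funext => x; rewrite Pu.
  rewrite (dzM z (mderivable_cst u) dphi) dz_cst mul0mx add0r.
  rewrite /Az (unitary_inv (mul_unitarymx uu (uphi z))) (unitary_inv (uphi z)).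
  move: (phi z) (dz phi z) => P D.
  rewrite adjM -mulmxA (mulmxA _ u) (unitary_mulV uu) mul1mx invrN1 opprK => ->.
  by rewrite scalerA mulVf ?scale1r// pnatr_eq0.
have [+ _] := AB (cis t) z; rewrite AE (unitary_inv (uPhi (cis t) z)).
move: (Phi (cis t) z) (uPhi (cis t) z) (dz (Phi (cis t)) z) => P uP D.
move=> /(congr1 (mulmx P)); rewrite mulmxA.
by have /unitarymxP -> := uP; rewrite mul1mx scalemxAr.
Qed.

(** [F] and [G] solve the same linear equation with [A] acting on the right, so F G^* has zero [dz];
    being unitary, it is constant. *)
Lemma extended_quotient_cst (A F G : R[i] -> 'M[R[i]]_n) (c : R[i]) :
  mderivable F -> mderivable G ->
  (forall z, F z \is unitarymx) -> (forall z, G z \is unitarymx) ->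
  (forall z, dz F z = c *: (F z *m A z)) ->
  (forall z, dz G z = c *: (G z *m A z)) ->
  forall z, (F 0)^t* *m F z = (G 0)^t* *m G z.
Proof.
move=> dF dG uF uG EF EG.
have dGa := mderivable_adj dG.
have H : forall z, F z *m (G z)^t* = F 0 *m (G 0)^t*.
  apply: (@cst_of_dz0_unitary R n (fun z => F z *m (G z)^t*)).
  - exact: mderivableM.
  - move=> z; apply/unitarymxP; rewrite adjM adjK -mulmxA (mulmxA _ (G z)).
    by rewrite unitary_mulV// mul1mx; apply/unitarymxP.
  - move=> z; rewrite (dzM z dF dGa) dz_adj_unitary// EF EG.
    move: (F z) (G z) (A z) (uG z) => P Q B uQ.
    have QQB : Q^t* *m (Q *m B) = B by rewrite mulmxA unitary_mulV// mul1mx.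
    have -> : P *m - (Q^t* *m (c *: (Q *m B)) *m Q^t*) = - (c *: (P *m B *m Q^t*)).
      by rewrite -scalemxAr QQB -scalemxAl mulmxN -scalemxAr mulmxA.
    by rewrite -scalemxAl subrr.
move=> z; have := congr1 (fun M => (F 0)^t* *m M *m G z) (H z) => /=.
rewrite -!mulmxA (unitary_mulV (uG z)) mulmx1 => ->.
by rewrite mulmxA (unitary_mulV (uF 0)) mul1mx.
Qed.

End ExtendedSolutions.

Lemma lattice_periodic (R : realType) (T : Type) (w1 w2 : R[i]) (f : R[i] -> T) :
  Defs.periodic w1 w2 f -> forall m1 m2 : nat, f (m1%:R * w1 + m2%:R * w2) = f 0.
Proof.
move=> fp m1 m2; elim: m2 => [|m2 IH].
  elim: m1 => [|m1 IH]; first by rewrite !mul0r addr0.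
  by move: IH; rewrite !mul0r !addr0 -natr1 mulrDl mul1r; have [-> _] := fp (m1%:R * w1).
by rewrite -natr1 mulrDl mul1r addrA -IH; have [_ ->] := fp (m1%:R * w1 + m2%:R * w2).
Qed.

Theorem theorem3p6 (R : realType) (n k : nat) (w1 w2 : R[i])
    (hw : lattice_basis w1 w2) (phi : R[i] -> 'M[R[i]]_n)
    (hphi : subbundle w1 w2 k phi)
    (hharm : harmonic_map (cartan phi))
    (huniton : finite_uniton_number w1 w2 (cartan phi))
    (htype : finite_type (cartan phi)) :
  exists P : 'M[R[i]]_n, forall z : R[i], phi z = P.
Proof.
have [sphi uphi _] := hharm; have dphi := smooth_mderivable sphi.
have [s [phi0 [alpha [u0 unis phiE]]]] := huniton.
have [Phi [d [xi [ePhi aPhi WE]]]] := htype.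
have [_ uPhi Phi1 _] := ePhi.
have {}phiE : cartan phi = uniton_product phi0 alpha s by apply/funext.
pose Psi l := factor_product phi0 alpha l s.
have GE l z : (Phi l 0)^t* *m Phi l z = (Psi (val l) 0)^t* *m Psi (val l) z.
  have [t ->] := cis_surj l.
  have [dPsi uPsi PsiE] := factor_product_spec u0 unis (cis t).
  rewrite -phiE in PsiE.
  exact: (extended_quotient_cst (extended_solution_mderivable t ePhi) dPsi
    (uPhi (cis t)) uPsi (extended_solution_dz ePhi aPhi dphi uphi t) PsiE z).
have cyc l (m1 m2 : nat) : Phi l (m1%:R * w1 + m2%:R * w2) = Phi l 0.
  have := GE l (m1%:R * w1 + m2%:R * w2).
  rewrite /Psi (lattice_periodic (factor_product_periodic _ unis)) -/(Psi _) -GE.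
  move=> /(congr1 (mulmx (Phi l 0))); rewrite !mulmxA.
  by have /unitarymxP -> := uPhi l 0; rewrite !mul1mx.
have W0 : loop_Hplus (fun l => Phi l 0) = @Hplus R n.
  rewrite WE; apply/seteqP; split=> [_ [f fH <-]|f fH].
    rewrite (_ : (fun l => _) = f)//; apply/funext => l.
    by rewrite scale0r expmx0 mul1mx.
  by exists f => //; apply/funext => l; rewrite scale0r expmx0 mul1mx.
(* At a lattice point w the vector exp(xi w) e_j lies in W(w) = W(0) = H_+. *)
have x0 : xi (- 1) = 0.
  apply: (laurent_principal_part_eq0 (d := d) hw) => m1 m2 j.
  rewrite -W0 -(_ : (fun l => Phi l (m1%:R * w1 + m2%:R * w2)) = (fun l => Phi l 0)).
    by rewrite WE; exists (fun=> delta_mx j 0) => //; exact: Hplus_cst.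
  by apply/funext => l; rewrite cyc.
have W z : loop_Hplus (fun l => Phi l z) = @Hplus R n.
  by rewrite WE; exact: loop_Hplus_expmx_laurent.
(* Phi(z') v lies in W(z') = W(z), so it is Phi(z) g with g in H_+, and unitarity identifies g. Both
   orders of the two points are used below. *)
have quot z z' (v : 'cV[R[i]]_n) :
    Hplus (fun l => ((Phi l z)^t* *m Phi l z') *m v).
  have [g gH gE] : loop_Hplus (fun l => Phi l z) (fun l => Phi l z' *m v).
    by rewrite W -(W z'); exists (fun=> v) => //; exact: Hplus_cst.
  rewrite (_ : (fun l => _) = g)//; apply/funext => l.
  rewrite -mulmxA -(congr1 (fun h => h l) gE) mulmxA.
  by rewrite (unitary_mulV (uPhi l z)) mul1mx.
have cst z i j t : ((Phi (cis t) 0)^t* *m Phi (cis t) z) i j = (1%:M : 'M[R[i]]_n) i j.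
  pose g (l : circle R) := ((Phi l 0)^t* *m Phi l z) i j.
  have g_poly : laurent_poly g.
    rewrite /g (_ : (fun l => _) =
      (fun l => ((Psi (val l) 0)^t* *m Psi (val l) z) i j)); last first.
      by apply/funext => l; rewrite GE.
    apply: laurent_poly_mulmx => [|a b]; last exact: laurent_poly_factor_product.
    by apply: laurent_poly_adj => a b; exact: laurent_poly_factor_product.
  have g_hardy : shardy (fun t => g (cis t)).
    have /HplusE/(_ i) := quot 0 z (delta_mx j 0).
    by congr shardy; apply/funext => u; rewrite -colE mxE.
  (* Exchanging 0 and z replaces the quotient by its adjoint, whence the transposed entry. *)
  have gc_hardy : shardy (fun t => Num.conj (g (cis t))).
    have /HplusE/(_ j) := quot z 0 (delta_mx i 0).
    congr shardy; apply/funext => u; rewrite -colE mxE /g.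
    move: (Phi (cis u) 0) (Phi (cis u) z) => P Q.
    have -> : Q^t* *m P = (P^t* *m Q)^t* by rewrite adjM adjK.
    by rewrite mxE [in LHS]mxE.
  rewrite -[LHS]/(g (cis t)) (laurent_poly_hardy_cst g_poly g_hardy gc_hardy) /g.
  have c0 : val (cis 0 : circle R) = 1.
    by apply/eqP; rewrite eq_complex /= cos0 sin0 !eqxx.
  by rewrite !Phi1// trmx1 map_mx1 mulmx1.
(* Angle pi is l = -1, where Phi recovers the map up to a constant unitary factor. *)
have Phi_cst z : Phi (cis pi) z = Phi (cis pi) 0.
  have E : (Phi (cis pi) 0)^t* *m Phi (cis pi) z = 1%:M.
    by apply/matrixP => i j; rewrite cst.
  have := congr1 (mulmx (Phi (cis pi) 0)) E; rewrite mulmxA mulmx1.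
  by have /unitarymxP -> := uPhi (cis pi) 0; rewrite mul1mx.
have [u uu Pu] := aPhi.
have cpi : val (cis (pi : R)) = -1.
  by apply/eqP; rewrite eq_complex /= cospi sinpi oppr0 !eqxx.
have car z : cartan phi z = cartan phi 0.
  have := Phi_cst z; rewrite !Pu// => /(congr1 (fun M => u^t* *m M)).
  by rewrite !mulmxA (unitary_mulV uu) !mul1mx.
(* The Cartan embedding is 2 phi - 1, so it determines phi. *)
exists (phi 0) => z; have := car z; rewrite /cartan !opprB !addrA => /addIr.
move=> /eqP; rewrite -!mulr2n -subr_eq0 -mulrnBl -scaler_nat scaler_eq0 pnatr_eq0 /=.
by rewrite subr_eq0 => /eqP.
Qed.
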